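(* Let $S$ be a band semigroup. Then $\mathcal{HH}^n(\ell^1(S))=0$ for every integer $n\ge 1$; that is, the simplicial cohomology of $\ell^1(S)$ is zero in degrees $1$ and above.
   Context: A band semigroup is a semigroup all of whose elements are idempotent; $\ell^1(S)$ is its convolution Banach algebra. For a Banach algebra $A$ and $n\ge 0$, $\mathcal{C}^n(A,A')$ is the space of bounded $n$-linear maps $T:A^n\to A'$ (with $\mathcal{C}^0(A,A')=A'$), where $A'$ is the dual of $A$ with its usual $A$-bimodule structure. The Hochschild coboundary $\delta:\mathcal{C}^n(A,A')\to\mathcal{C}^{n+1}(A,A')$ is $$(\delta T)(a_1,\ldots,a_{n+1})(a_{n+2}) = T(a_2,\ldots,a_{n+1})(a_{n+2}a_1)+\sum_{j=1}^{n}(-1)^jT(a_1,\ldots,a_ja_{j+1},\ldots,a_{n+1})(a_{n+2})+(-1)^{n+1}T(a_1,\ldots,a_n)(a_{n+1}a_{n+2}).$$ $\mathcal{Z}^n(A,A')=\ker\delta$ and $\mathcal{B}^n(A,A')=\delta(\mathcal{C}^{n-1}(A,A'))$ in degree $n$, and the $n$th simplicial cohomology group is $\mathcal{HH}^n(A)=\mathcal{Z}^n(A,A')/\mathcal{B}^n(A,A')$. *)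

(* Defs.v *)
From HB Require Import structures.
From mathcomp Require Import all_boot all_order all_algebra.
From mathcomp Require Import mathcomp_extra boolp classical_sets functions.
From mathcomp Require Import cardinality fsbigop reals ereal topology normedtype.
From mathcomp Require Import numfun esum.
From mathcomp Require Import finmap complex ring_quotient zify ring lra.

Set Implicit Arguments.
Unset Strict Implicit.
Unset Printing Implicit Defensive.

Import Order.TTheory GRing.Theory Num.Theory.
Import numFieldNormedType.Exports.

Local Open Scope classical_set_scope.
Local Open Scope ring_scope.

(* Banach algebras, not assumed to be unital. *)
HB.mixin Record CompleteNormedModule_isBanachAlgebra (K : numFieldType) A
    of CompleteNormedModule K A := {
  bmul : A -> A -> A;
  bmulA : associative bmul;
  bmulDl : left_distributive bmul +%R;
  bmulDr : right_distributive bmul +%R;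
  bscalerAl : forall (k : K) (a b : A), k *: bmul a b = bmul (k *: a) b;
  bscalerAr : forall (k : K) (a b : A), k *: bmul a b = bmul a (k *: b);
  ler_norm_bmul : forall a b : A, `|bmul a b| <= `|a| * `|b|
}.

#[short(type="banachAlgType")]
HB.structure Definition BanachAlgebra (K : numFieldType) :=
  {A of CompleteNormedModule K A & CompleteNormedModule_isBanachAlgebra K A}.

Notation "a ∗ b" := (bmul a b) (at level 40, left associativity) : ring_scope.

Section Dual.
Variables (K : numFieldType) (A : banachAlgType K).

Definition is_bounded_functional (f : A -> K^o) : Prop :=
  linear f /\ exists M : K, forall a, `|f a| <= M * `|a|.

Definition tdual_pred : {pred A -> K^o} := [pred f | `[< is_bounded_functional f >]].

Lemma tdual_pred_submod : submod_closed tdual_pred.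
Proof.
split.
  apply/asboolP; split; first by move=> k x y; rewrite /= scaler0 addr0.
  by exists 0 => a; rewrite normr0 mul0r.
move=> k f g /asboolP[fl [M fM]] /asboolP[gl [N gN]]; apply/asboolP; split.
  move=> c x y; rewrite !fctE fl gl !scalerDr !scalerA [c * k]mulrC.
  by rewrite addrACA.
exists (`|k| * M + N) => a; rewrite !fctE (le_trans (ler_normD _ _))// mulrDl.
by rewrite lerD// normrZ -mulrA ler_wpM2l.
Qed.

HB.instance Definition _ :=
  GRing.isSubmodClosed.Build K (A -> K^o) tdual_pred tdual_pred_submod.

Record tdual := Dual { tdual_val :> A -> K^o; _ : tdual_val \in tdual_pred }.

HB.instance Definition _ := [isSub for tdual_val].
HB.instance Definition _ := [Choice of tdual by <:].
HB.instance Definition _ := [SubChoice_isSubLmodule of tdual by <:].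

Lemma tdualP (f : tdual) : is_bounded_functional f.
Proof. by case: f => f /= /asboolP. Qed.

Lemma tdual_ext (f g : tdual) : (forall a, f a = g a) -> f = g.
Proof. by move=> fg; apply/val_inj/funext. Qed.

Lemma tdual0E a : (0 : tdual) a = 0. Proof. by []. Qed.
Lemma tdualDE (f g : tdual) a : (f + g) a = f a + g a. Proof. by []. Qed.
Lemma tdualZE k (f : tdual) a : (k *: f) a = k *: f a. Proof. by []. Qed.
Lemma tdual_sumE I (r : seq I) P (F : I -> tdual) a :
  (\sum_(i <- r | P i) F i) a = \sum_(i <- r | P i) F i a.
Proof. by elim/big_rec2: _ => // i x y _ <-. Qed.

Lemma tdual_lact_subproof (a : A) (f : tdual) : (fun b => f (b ∗ a)) \in tdual_pred.
Proof.
have [fl [M fM]] := tdualP f; apply/asboolP; split.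
  by move=> k x y; rewrite bmulDl -bscalerAl fl.
exists (`|M| * `|a|) => b; have := fM (b ∗ a) => le1.
have M0 : 0 <= M * `|b ∗ a| by exact: le_trans le1.
rewrite (le_trans le1)// -(ger0_norm M0) normrM normr_id -mulrA ler_wpM2l//.
by rewrite mulrC ler_norm_bmul.
Qed.

Lemma tdual_ract_subproof (f : tdual) (a : A) : (fun b => f (a ∗ b)) \in tdual_pred.
Proof.
have [fl [M fM]] := tdualP f; apply/asboolP; split.
  by move=> k x y; rewrite bmulDr -bscalerAr fl.
exists (`|M| * `|a|) => b; have := fM (a ∗ b) => le1.
have M0 : 0 <= M * `|a ∗ b| by exact: le_trans le1.
rewrite (le_trans le1)// -(ger0_norm M0) normrM normr_id -mulrA ler_wpM2l//.
by rewrite ler_norm_bmul.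
Qed.

(* The A-bimodule structure of the dual: (a . f)(b) = f (ba) and
   (f . a)(b) = f (ab). *)
Definition tdual_lact (a : A) (f : tdual) : tdual := Dual (tdual_lact_subproof a f).
Definition tdual_ract (f : tdual) (a : A) : tdual := Dual (tdual_ract_subproof f a).

Lemma tdual_lact_linearl (f : tdual) : linear (tdual_lact^~ f).
Proof.
by move=> k x y; apply: tdual_ext => b; have [fl _] := tdualP f;
  rewrite tdualDE tdualZE /= bmulDr -bscalerAr fl.
Qed.

Lemma tdual_lact_linearr a : linear (tdual_lact a).
Proof. by move=> k f g; apply: tdual_ext. Qed.

Lemma tdual_ract_linearl a : linear (tdual_ract^~ a).
Proof. by move=> k f g; apply: tdual_ext. Qed.

Lemma tdual_ract_linearr (f : tdual) : linear (tdual_ract f).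
Proof.
by move=> k x y; apply: tdual_ext => b; have [fl _] := tdualP f;
  rewrite tdualDE tdualZE /= bmulDl -bscalerAl fl.
Qed.

End Dual.

Section Cochain.
Variables (K : numFieldType) (A : banachAlgType K).

Definition upd n (a : 'I_n -> A) (i : 'I_n) (x : A) : 'I_n -> A :=
  fun j => if j == i then x else a j.

(* The bound says that the operator norm of T a is at most
   M * \prod_i `|a i|. *)
Definition is_cochain n (T : ('I_n -> A) -> tdual A) : Prop :=
  (forall a i, linear (fun x => T (upd a i x))) /\
  exists M : K, forall a b, `|T a b| <= M * (\prod_i `|a i|) * `|b|.

Definition cochain_pred n : {pred ('I_n -> A) -> tdual A} :=
  [pred T | `[< is_cochain T >]].

Lemma cochain_pred_submod n : submod_closed (@cochain_pred n).
Proof.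
split.
  apply/asboolP; split; first by move=> a i k x y; rewrite /= scaler0 addr0.
  by exists 0 => a b; rewrite !mul0r normr0.
move=> k f g /asboolP[fl [M fM]] /asboolP[gl [N gN]]; apply/asboolP; split.
  move=> a i c x y; rewrite !fctE fl gl !scalerDr !scalerA [c * k]mulrC.
  by rewrite addrACA.
exists (`|k| * M + N) => a b; rewrite !fctE tdualDE tdualZE.
rewrite (le_trans (ler_normD _ _))// !mulrDl.
by rewrite lerD// normrZ -!mulrA ler_wpM2l// mulrA.
Qed.

HB.instance Definition _ n := GRing.isSubmodClosed.Build K
  (('I_n -> A) -> tdual A) (@cochain_pred n) (cochain_pred_submod n).

(* The space C^n(A, A'). *)
Record cochain n := Cochain {
  cochain_val :> ('I_n -> A) -> tdual A;
  _ : cochain_val \in @cochain_pred n }.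

HB.instance Definition _ n := [isSub for @cochain_val n].
HB.instance Definition _ n := [Choice of cochain n by <:].
HB.instance Definition _ n := [SubChoice_isSubLmodule of cochain n by <:].

Lemma cochainP n (T : cochain n) : is_cochain T.
Proof. by case: T => T /= /asboolP. Qed.

Lemma cochain_ext n (T U : cochain n) : (forall a, T a = U a) -> T = U.
Proof. by move=> TU; apply/val_inj/funext. Qed.

Lemma cochain_bound n (T : cochain n) : exists2 M : K, 0 <= M &
  forall a b, `|T a b| <= M * (\prod_i `|a i|) * `|b|.
Proof.
have [_ [M TM]] := cochainP T; exists `|M| => // a b.
have le1 := TM a b; rewrite (le_trans le1)//.
have : 0 <= M * (\prod_i `|a i|) * `|b| by exact: le_trans le1.
move=> /ger0_norm <-; rewrite !normrM normr_id normr_prod.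
by under eq_bigr do rewrite normr_id.
Qed.

Definition tail n (a : 'I_n.+1 -> A) : 'I_n -> A := fun i => a (lift ord0 i).
Definition init n (a : 'I_n.+1 -> A) : 'I_n -> A :=
  fun i => a (widen_ord (leqnSn n) i).

(* (a_0, ..., a_j a_{j+1}, ..., a_n) *)
Definition contract n (j : 'I_n) (a : 'I_n.+1 -> A) : 'I_n -> A := fun i =>
  if (i < j)%N then init a i
  else if i == j then init a j ∗ tail a j
  else tail a i.

(* Indices start at 0 here, so that the signs are (-1)^(j+1) for the product
   a_j a_{j+1}. *)
Definition hdelta_fun n (T : ('I_n -> A) -> tdual A) (a : 'I_n.+1 -> A) : tdual A :=
  tdual_lact (a ord0) (T (tail a))
  + \sum_(j < n) (-1) ^+ j.+1 *: T (contract j a)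
  + (-1) ^+ n.+1 *: tdual_ract (T (init a)) (a ord_max).

Lemma hdelta_funE n (T : ('I_n -> A) -> tdual A) (a : 'I_n.+1 -> A) (b : A) :
  hdelta_fun T a b =
  T (tail a) (b ∗ a ord0)
  + \sum_(j < n) (-1) ^+ j.+1 * T (contract j a) b
  + (-1) ^+ n.+1 * T (init a) (a ord_max ∗ b).
Proof. by rewrite !tdualDE tdual_sumE. Qed.

Lemma ord_caseS n (i : 'I_n.+1) : i = ord0 \/ exists j, i = lift ord0 j.
Proof. by case: (unliftP ord0 i) => [j ->|->]; [right; exists j|left]. Qed.

Lemma ord_casemax n (i : 'I_n.+1) :
  i = ord_max \/ exists j, i = widen_ord (leqnSn n) j.
Proof.
case: (unliftP ord_max i) => [j ->|->]; [right; exists j|by left].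
by apply: val_inj; rewrite /= /bump leqNgt ltn_ord.
Qed.

Lemma tail_upd0 n (a : 'I_n.+1 -> A) x : tail (upd a ord0 x) = tail a.
Proof. by apply/funext => i; rewrite /tail /upd. Qed.

Lemma tail_updS n (a : 'I_n.+1 -> A) i x :
  tail (upd a (lift ord0 i) x) = upd (tail a) i x.
Proof.
apply/funext => j; rewrite /tail /upd.
by rewrite (inj_eq (@lift_inj _ _)).
Qed.

Lemma widen_inj n : injective (widen_ord (leqnSn n)).
Proof. by move=> i j /(congr1 val) /= ij; apply: val_inj. Qed.

Lemma init_updmax n (a : 'I_n.+1 -> A) x : init (upd a ord_max x) = init a.
Proof.
apply/funext => i; rewrite /init /upd ifN//.
by rewrite -val_eqE /= ltn_eqF.
Qed.

Lemma init_updW n (a : 'I_n.+1 -> A) i x :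
  init (upd a (widen_ord (leqnSn n) i) x) = upd (init a) i x.
Proof.
by apply/funext => j; rewrite /init /upd (inj_eq (@widen_inj _)).
Qed.

Lemma contract_upd n (j : 'I_n) (a : 'I_n.+1 -> A) (k : 'I_n.+1) :
  exists i : 'I_n, exists2 g : A -> A, linear g &
    forall x, contract j (upd a k x) = upd (contract j a) i (g x).
Proof.
have [kj|jk|kj] := ltngtP k j.
- have kn : (k < n)%N by rewrite (ltn_trans kj).
  exists (Ordinal kn); exists id => // x; apply/funext => i.
  rewrite /contract /upd /init /tail -!val_eqE /= /bump.
  by have [ij|ji|ij] := ltngtP i j; repeat case: eqP => //=; lia.
- case: (ord_caseS k) jk => [->//|[i ->]]; rewrite /= /bump leq0n add1n ltnS.
  rewrite leq_eqVlt => /orP[/eqP/val_inj <-|ji].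
    exists j; exists (fun x => init a j ∗ x).
      by move=> c x y; rewrite bmulDr bscalerAr.
    move=> x; apply/funext => l.
    rewrite /contract /upd /init /tail -!val_eqE /= /bump !leq0n !add1n.
    by have [lj|jl|lj] := ltngtP l j; repeat case: eqP => //=; lia.
  exists i; exists id => // x; apply/funext => l.
  rewrite /contract /upd /init /tail -!val_eqE /= /bump !leq0n !add1n.
  by have [lj|jl|lj] := ltngtP l j; repeat case: eqP => //=; lia.
- exists j; exists (fun x => x ∗ tail a j).
    by move=> c x y; rewrite bmulDl bscalerAl.
  move=> x; apply/funext => l.
  rewrite /contract /upd /init /tail -!val_eqE /= /bump !leq0n !add1n.
  by have [lj|jl|lj] := ltngtP l j; repeat case: eqP => //=; lia.
Qed.

Lemma prod_norm_contract n (j : 'I_n) (a : 'I_n.+1 -> A) :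
  \prod_i `|contract j a i| <= \prod_i `|a i|.
Proof.
have jj : lift (widen_ord (leqnSn n) j) j = lift ord0 j.
  by apply: val_inj; rewrite /= /bump leqnn.
rewrite [leRHS](bigD1_ord (widen_ord (leqnSn n) j))// [leLHS](bigD1 j)//=.
rewrite [X in _ <= _ * X](bigD1 j)//=.
rewrite jj mulrA ler_pM ?prodr_ge0//.
  by rewrite /contract ltnn eqxx ler_norm_bmul.
rewrite le_eqVlt; apply/orP; left; apply/eqP; apply: eq_bigr => i ij.
rewrite /contract (negPf ij); case: ltnP => ji; congr `|a _|;
  apply: val_inj; rewrite /= /bump.
  by rewrite leqNgt ji.
by rewrite ji.
Qed.

Lemma linear_addf (V W : lmodType K) (f g : V -> W) :
  linear f -> linear g -> linear (fun x => f x + g x).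
Proof. by move=> fl gl k x y; rewrite fl gl scalerDr addrACA. Qed.

Lemma linear_scalef (V W : lmodType K) (c : K) (f : V -> W) :
  linear f -> linear (fun x => c *: f x).
Proof. by move=> fl k x y; rewrite fl scalerDr !scalerA mulrC. Qed.

Lemma linear_sumf (V W : lmodType K) I (r : seq I) (F : I -> V -> W) :
  (forall i, linear (F i)) -> linear (fun x => \sum_(i <- r) F i x).
Proof.
move=> Fl k x y; rewrite scaler_sumr -big_split/=.
by apply: eq_bigr => i _; rewrite Fl.
Qed.

Lemma hdelta_subproof n (T : cochain n) : hdelta_fun T \in @cochain_pred n.+1.
Proof.
have [Tl _] := cochainP T; have [M M0 TM] := cochain_bound T.
apply/asboolP; split.
  move=> a k; rewrite /hdelta_fun; apply: linear_addf; first apply: linear_addf.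
  - have [->|[i ->]] := ord_caseS k.
      move=> c x y; rewrite !tail_upd0 /upd !eqxx.
      exact: tdual_lact_linearl.
    move=> c x y; rewrite !tail_updS Tl /upd /=.
    by rewrite tdual_lact_linearr.
  - apply: linear_sumf => j; apply: linear_scalef.
    have [i [g gl gE]] := contract_upd j a k.
    by move=> c x y; rewrite !gE gl Tl.
  - apply: linear_scalef; have [->|[i ->]] := ord_casemax k.
      move=> c x y; rewrite !init_updmax /upd !eqxx.
      exact: tdual_ract_linearr.
    move=> c x y; rewrite !init_updW Tl /upd.
    rewrite (_ : ord_max == _ = false) ?tdual_ract_linearl//.
    by rewrite -val_eqE /= gtn_eqF.
exists (M + n%:R * M + M) => a b; rewrite hdelta_funE.
rewrite (le_trans (ler_normD _ _))// !mulrDl lerD//; last first.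
  rewrite normrM normrX normrN1 expr1n mul1r (le_trans (TM _ _))//.
  rewrite big_ord_recr/= -!mulrA !ler_wpM2l ?prodr_ge0//.
  exact: ler_norm_bmul.
rewrite (le_trans (ler_normD _ _))// lerD//.
  rewrite (le_trans (TM _ _))// big_ord_recl/= -!mulrA ler_wpM2l//.
  by rewrite mulrCA ler_wpM2l ?prodr_ge0// mulrC ler_norm_bmul.
rewrite (le_trans (ler_norm_sum _ _ _))//.
apply: (@le_trans _ _ (\sum_(j < n) M * (\prod_i `|a i|) * `|b|)).
  apply: ler_sum => j _; rewrite normrM normrX normrN1 expr1n mul1r.
  rewrite (le_trans (TM _ _))// ler_wpM2r// ler_wpM2l//.
  exact: prod_norm_contract.
by rewrite sumr_const card_ord -!mulrA [leRHS]mulr_natl.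
Qed.

Definition hdelta n (T : cochain n) : cochain n.+1 := Cochain (hdelta_subproof T).

Lemma hdelta_linear n : linear (@hdelta n).
Proof.
move=> k T U; apply: cochain_ext => a; apply: tdual_ext => b.
have E a' b' : (k *: T + U) a' b' = k * T a' b' + U a' b' by [].
rewrite -[LHS]/(hdelta_fun (k *: T + U) a b).
rewrite -[RHS]/(k * hdelta_fun T a b + hdelta_fun U a b) !hdelta_funE !E.
under eq_bigr do rewrite E mulrDr mulrCA.
by rewrite big_split/= -mulr_sumr; ring.
Qed.

HB.instance Definition _ n :=
  GRing.isLinear.Build K (cochain n) (cochain n.+1) _ (@hdelta n) (@hdelta_linear n).

Definition cocycle_pred n : {pred cochain n} := [pred T | hdelta T == 0].

Lemma cocycle_pred_submod n : submod_closed (@cocycle_pred n).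
Proof.
split; first by apply/eqP; rewrite linear0.
move=> k T U /eqP TZ /eqP UZ; apply/eqP.
by rewrite hdelta_linear TZ UZ scaler0 addr0.
Qed.

HB.instance Definition _ n := GRing.isSubmodClosed.Build K
  (cochain n) (@cocycle_pred n) (cocycle_pred_submod n).

(* The space Z^n(A, A'). *)
Record cocycle n := Cocycle {
  cocycle_val :> cochain n;
  _ : cocycle_val \in @cocycle_pred n }.

HB.instance Definition _ n := [isSub for @cocycle_val n].
HB.instance Definition _ n := [Choice of cocycle n by <:].
HB.instance Definition _ n := [SubChoice_isSubLmodule of cocycle n by <:].

(* By convention B^0 = 0. *)
Definition is_coboundary n : cochain n -> Prop :=
  match n with
  | 0 => fun T => T = 0
  | m.+1 => fun T => exists U : cochain m, T = hdelta U
  end.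

(* The space B^n(A, A'), as a subspace of Z^n(A, A'). *)
Definition coboundary n : {pred cocycle n} :=
  [pred T : cocycle n | `[< is_coboundary (cocycle_val T) >]].

Lemma coboundary_submod n : submod_closed (@coboundary n).
Proof.
split.
  by apply/asboolP; case: n => [//|n]; exists 0; rewrite linear0.
move=> k T U /asboolP TB /asboolP UB; apply/asboolP.
case: n T U TB UB => [|n] T U /=; first by move=> -> ->; rewrite scaler0 addr0.
by move=> [V ->] [W ->]; exists (k *: V + W); rewrite hdelta_linear.
Qed.

HB.instance Definition _ n := GRing.isSubmodClosed.Build K
  (cocycle n) (@coboundary n) (coboundary_submod n).

End Cochain.

(* The simplicial cohomology groups HH^n(A) = Z^n(A, A') / B^n(A, A'). *)
Definition HH (K : numFieldType) (A : banachAlgType K) (n : nat) : zmodType :=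
  Quotient.quot (@coboundary K A n).

Lemma HH_eq0P (K : numFieldType) (A : banachAlgType K) (n : nat) :
  (forall x : HH A n, x = 0) <->
  (forall T : cochain A n, hdelta T = 0 -> is_coboundary T).
Proof.
split=> [H T T0|H x].
  have TZ : T \in @cocycle_pred K A n by apply/eqP.
  pose Z : cocycle A n := Cocycle TZ.
  have := H (\pi_(Quotient.quot (@coboundary K A n)) Z)%qT.
  rewrite -[0](@pi_zeror _ _ _ _ _ (Quotient.quot (@coboundary K A n))).
  move=> /eqP; rewrite -Quotient.idealrBE subr0 => /asboolP//.
rewrite -[x]reprK -[0](@pi_zeror _ _ _ _ _ (Quotient.quot (@coboundary K A n))).
apply/eqP; rewrite -Quotient.idealrBE subr0; apply/asboolP/H.
by case: (repr x) => T /= /eqP.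
Qed.

Section NonnegSum.
Variable R : realType.
Implicit Types (T : choiceType).

(* Sums of families of nonnegative reals. *)
Definition nsum T (p : T -> R) : R := fine (\esum_(x in [set: T]) (p x)%:E).
Definition nsummable T (p : T -> R) : Prop :=
  (\esum_(x in [set: T]) (p x)%:E < +oo)%E.

Lemma nsum_fin T (p : T -> R) : (forall x, 0 <= p x) -> nsummable p ->
  (nsum p)%:E = \esum_(x in [set: T]) (p x)%:E.
Proof.
move=> p0 ps; rewrite fineK// ge0_fin_numE//.
by apply: esum_ge0 => x _; rewrite lee_fin.
Qed.

Lemma nsum_ge0 T (p : T -> R) : (forall x, 0 <= p x) -> 0 <= nsum p.
Proof. by move=> p0; apply/fine_ge0/esum_ge0 => x _; rewrite lee_fin. Qed.

Lemma nsummable_le T (p q : T -> R) : (forall x, p x <= q x) ->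
  nsummable q -> nsummable p.
Proof.
by move=> pq; apply: le_lt_trans; apply: le_esum => x _; rewrite lee_fin.
Qed.

Lemma nsum_le T (p q : T -> R) : (forall x, 0 <= p x) ->
  (forall x, p x <= q x) -> nsummable q -> nsum p <= nsum q.
Proof.
move=> p0 pq qs; have ps := nsummable_le pq qs.
rewrite -lee_fin !nsum_fin//; last by move=> x; exact: le_trans (pq x).
by apply: le_esum => x _; rewrite lee_fin.
Qed.

Lemma nsummableD T (p q : T -> R) : (forall x, 0 <= p x) ->
  (forall x, 0 <= q x) -> nsummable p -> nsummable q ->
  nsummable (fun x => p x + q x).
Proof.
move=> p0 q0 ps qs; rewrite /nsummable.
under eq_esum do rewrite EFinD.
by rewrite esumD ?lte_add_pinfty// => x _; rewrite lee_fin.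
Qed.

Lemma nsumD T (p q : T -> R) : (forall x, 0 <= p x) ->
  (forall x, 0 <= q x) -> nsummable p -> nsummable q ->
  nsum (fun x => p x + q x) = nsum p + nsum q.
Proof.
move=> p0 q0 ps qs; apply: EFin_inj; rewrite EFinD !nsum_fin//.
- by rewrite -esumD => [|x _|x _]; rewrite ?lee_fin.
- by move=> x; rewrite addr_ge0.
- exact: nsummableD.
Qed.

Lemma esumZ T (p : T -> R) (c : R) : 0 <= c -> (forall x, 0 <= p x) ->
  (\esum_(x in [set: T]) (c * p x)%:E = c%:E * \esum_(x in [set: T]) (p x)%:E)%E.
Proof.
move=> c0 p0; rewrite /esum -ereal_supZl//; last first.
  by apply/set0P; exists 0%E; exists set0; rewrite ?fsbig_set0.
congr ereal_sup; rewrite image_comp; apply: eq_imagel => X [Xfin _] /=.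
rewrite !fsbig_finite//= !sumEFin -EFinM; congr EFin.
by rewrite mulr_sumr.
Qed.

Lemma nsummableZ T (p : T -> R) (c : R) : 0 <= c -> (forall x, 0 <= p x) ->
  nsummable p -> nsummable (fun x => c * p x).
Proof.
move=> c0 p0 ps; rewrite /nsummable esumZ// -nsum_fin//.
by rewrite -EFinM ltry.
Qed.

Lemma nsumZ T (p : T -> R) (c : R) : 0 <= c -> (forall x, 0 <= p x) ->
  nsummable p -> nsum (fun x => c * p x) = c * nsum p.
Proof.
move=> c0 p0 ps; apply: EFin_inj; rewrite nsum_fin ?esumZ ?EFinM ?nsum_fin//.
  by move=> x; rewrite mulr_ge0.
exact: nsummableZ.
Qed.

Lemma nsum_ge T (p : T -> R) x : (forall x, 0 <= p x) -> nsummable p ->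
  p x <= nsum p.
Proof.
move=> p0 ps; rewrite -lee_fin nsum_fin//; apply: esum_ge.
by exists [set x]; rewrite ?fsbig_set1//; split.
Qed.

Lemma nsum_le_fset T (p : T -> R) (M : R) : (forall x, 0 <= p x) ->
  (forall X : {fset T}, \sum_(x <- X) p x <= M) ->
  nsummable p /\ nsum p <= M.
Proof.
move=> p0 pM; have pM' : (\esum_(x in [set: T]) (p x)%:E <= M%:E)%E.
  apply: ge_ereal_sup => /= _ [X [Xfin _]] <-.
  by rewrite fsbig_finite//= sumEFin lee_fin.
have ps : nsummable p by rewrite /nsummable (le_lt_trans pM') ?ltry.
by split=> //; rewrite -lee_fin nsum_fin.
Qed.

Lemma nsum_ge_fset T (p : T -> R) (X : {fset T}) : (forall x, 0 <= p x) ->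
  nsummable p -> \sum_(x <- X) p x <= nsum p.
Proof.
move=> p0 ps; rewrite -lee_fin nsum_fin// -sumEFin; apply: esum_ge.
by exists [set` X]; [split|rewrite fsbig_finite//= set_fsetK].
Qed.

Lemma esum_pair (T1 T2 : choiceType) (p : T1 * T2 -> R) : (forall x, 0 <= p x) ->
  \esum_(x in [set: T1]) \esum_(y in [set: T2]) (p (x, y))%:E
  = \esum_(z in [set: T1 * T2]) (p z)%:E.
Proof.
move=> p0; rewrite esum_esum => [|x y _ _]; rewrite ?lee_fin//.
rewrite (_ : _ `*`` _ = setT); last by apply/seteqP; split.
by apply: eq_esum => -[].
Qed.

Lemma nsummable_pair1 (T1 T2 : choiceType) (p : T1 * T2 -> R) :
  (forall x, 0 <= p x) -> nsummable p ->
  forall x, nsummable (fun y => p (x, y)).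
Proof.
move=> p0 ps x; move: ps; rewrite /nsummable -esum_pair//.
apply: le_lt_trans.
apply: esum_ge; exists [set x]; first by split.
by rewrite fsbig_set1.
Qed.

Lemma nsummable_pair2 (T1 T2 : choiceType) (p : T1 * T2 -> R) :
  (forall x, 0 <= p x) -> nsummable p ->
  nsummable (fun x => nsum (fun y => p (x, y))).
Proof.
move=> p0 ps; rewrite /nsummable.
rewrite (eq_esum (fun x _ => nsum_fin (fun y => p0 (x, y))
  (nsummable_pair1 p0 ps x))).
by rewrite esum_pair.
Qed.

Lemma nsum_pair (T1 T2 : choiceType) (p : T1 * T2 -> R) :
  (forall x, 0 <= p x) -> nsummable p ->
  nsum p = nsum (fun x => nsum (fun y => p (x, y))).
Proof.
move=> p0 ps; apply: EFin_inj; rewrite !nsum_fin//.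
- rewrite -esum_pair//; apply: eq_esum => x _; rewrite nsum_fin//.
  exact: nsummable_pair1.
- by move=> x; exact: nsum_ge0.
- exact: nsummable_pair2.
Qed.

Lemma nsummable_prod (T1 T2 : choiceType) (p : T1 -> R) (q : T2 -> R) :
  (forall x, 0 <= p x) -> (forall x, 0 <= q x) ->
  nsummable p -> nsummable q ->
  nsummable (fun z : T1 * T2 => p z.1 * q z.2) /\
  nsum (fun z : T1 * T2 => p z.1 * q z.2) = nsum p * nsum q.
Proof.
move=> p0 q0 ps qs.
have E : \esum_(z in [set: T1 * T2]) (p z.1 * q z.2)%:E = (nsum p * nsum q)%:E.
  rewrite -esum_pair/=; last by move=> z; rewrite mulr_ge0.
  under eq_esum => x _ do rewrite esumZ// -nsum_fin// -EFinM mulrC.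
  by rewrite esumZ ?nsum_ge0// -nsum_fin// -EFinM mulrC.
by split; rewrite /nsummable /nsum E ?ltry.
Qed.

Lemma esum_reindexT (T1 T2 : choiceType) (e : T1 -> T2) (p : T2 -> R) :
  bijective e ->
  \esum_(x in [set: T2]) (p x)%:E = \esum_(x in [set: T1]) (p (e x))%:E.
Proof.
by move=> ebij; apply: reindex_esum; rewrite setTT_bijective.
Qed.

End NonnegSum.

(* Unordered sums over D, meant for absolutely summable families only: a real
   sum is the difference of the sums of the positive and negative parts, a
   complex one is computed on real and imaginary parts. *)
Definition rsum (R : realType) (T : choiceType) (D : set T) (h : T -> R) : R :=
  fine (\esum_(x in D) (h^\+ x)%:E) - fine (\esum_(x in D) (h^\- x)%:E).

Definition csum (R : realType) (T : choiceType) (D : set T) (h : T -> R[i]) :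
  R[i] :=
  Complex (rsum D (fun x => complex.Re (h x))) (rsum D (fun x => complex.Im (h x))).

Section RealSum.
Variable R : realType.
Implicit Types (T : choiceType).

Lemma rsum_mkcond T (D : set T) (h : T -> R) :
  rsum D h = rsum setT (fun x => if x \in D then h x else 0).
Proof.
rewrite /rsum !(esum_mkcond D).
by congr (fine _ - fine _); apply: eq_esum => x _; case: ifP => xD;
  rewrite /funrpos /funrneg xD// ?oppr0 maxxx.
Qed.

Lemma posnegE T (h : T -> R) x : h x = h^\+ x - h^\- x.
Proof. by rewrite -[in LHS](funrposBneg h). Qed.

Lemma rsumE T (h : T -> R) : rsum setT h = nsum h^\+ - nsum h^\-.
Proof. by []. Qed.

Lemma rsummableP T (h : T -> R) : nsummable (fun x => `|h x|) ->
  nsummable h^\+ /\ nsummable h^\-.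
Proof.
move=> hs; split; apply: nsummable_le hs => x.
  by rewrite /funrpos ge_max normr_ge0 ler_norm.
by rewrite /funrneg ge_max normr_ge0 -normrN ler_norm.
Qed.

Lemma rsumB T (p q h : T -> R) : (forall x, 0 <= p x) -> (forall x, 0 <= q x) ->
  nsummable p -> nsummable q -> (forall x, h x = p x - q x) ->
  rsum setT h = nsum p - nsum q.
Proof.
move=> p0 q0 ps qs hpq.
have [hp hn] : nsummable h^\+ /\ nsummable h^\-.
  apply: rsummableP; apply: (@nsummable_le _ _ _ (fun x => p x + q x)).
    by move=> x; rewrite hpq (le_trans (ler_normB _ _))// !ger0_norm.
  exact: nsummableD.
have hp0 := @funrpos_ge0 T R h; have hn0 := @funrneg_ge0 T R h.
have : nsum h^\+ + nsum q = nsum p + nsum h^\-.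
  rewrite -!nsumD//; congr nsum; apply/funext => x.
  by have := posnegE h x; rewrite hpq /= => E; lra.
by rewrite rsumE => E; lra.
Qed.

Lemma rsumD T (h k : T -> R) :
  nsummable (fun x => `|h x|) -> nsummable (fun x => `|k x|) ->
  rsum setT (fun x => h x + k x) = rsum setT h + rsum setT k.
Proof.
move=> /rsummableP[hp hn] /rsummableP[kp kn].
have hp0 := @funrpos_ge0 T R h; have hn0 := @funrneg_ge0 T R h.
have kp0 := @funrpos_ge0 T R k; have kn0 := @funrneg_ge0 T R k.
rewrite (@rsumB _ (fun x => h^\+ x + k^\+ x) (fun x => h^\- x + k^\- x)).
- by rewrite !nsumD// !rsumE; ring.
- by move=> x; rewrite addr_ge0.
- by move=> x; rewrite addr_ge0.
- exact: nsummableD.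
- exact: nsummableD.
- by move=> x; rewrite (posnegE h) (posnegE k); ring.
Qed.

Lemma rsumN T (h : T -> R) : rsum setT (fun x => - h x) = - rsum setT h.
Proof.
by rewrite !rsumE funrposN funrnegN opprB.
Qed.

Lemma rsumZ T (c : R) (h : T -> R) : nsummable (fun x => `|h x|) ->
  rsum setT (fun x => c * h x) = c * rsum setT h.
Proof.
wlog c0 : c / 0 <= c => [wl hs|/rsummableP[hp hn]].
  have [c0|c0] := leP 0 c; first exact: wl.
  rewrite -[in RHS](opprK c) mulNr -wl ?oppr_ge0 ?ltW// -rsumN.
  by congr rsum; apply/funext => x; rewrite mulNr opprK.
have hp0 := @funrpos_ge0 T R h; have hn0 := @funrneg_ge0 T R h.
by rewrite !rsumE ge0_funrposM// ge0_funrnegM// !nsumZ// mulrBr.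
Qed.

Lemma rsum_norm T (h : T -> R) : nsummable (fun x => `|h x|) ->
  `|rsum setT h| <= nsum (fun x => `|h x|).
Proof.
move=> hs; have [hp hn] := rsummableP hs.
have hp0 := @funrpos_ge0 T R h; have hn0 := @funrneg_ge0 T R h.
rewrite (_ : (fun x => `|h x|) = (fun x => h^\+ x + h^\- x)); last first.
  by have := funrposDneg h; rewrite addrfctE /comp => ->.
rewrite rsumE nsumD// (le_trans (ler_normB _ _))//.
by rewrite !ger0_norm// nsum_ge0.
Qed.

Lemma rsum_pair (T1 T2 : choiceType) (h : T1 * T2 -> R) :
  nsummable (fun z => `|h z|) ->
  rsum setT h = rsum setT (fun x => rsum setT (fun y => h (x, y))).
Proof.
move=> /rsummableP[hp hn].
have hp0 := @funrpos_ge0 _ R h; have hn0 := @funrneg_ge0 _ R h.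
rewrite rsumE (nsum_pair hp0 hp) (nsum_pair hn0 hn); apply/esym/rsumB => //.
- by move=> x; apply: nsum_ge0.
- by move=> x; apply: nsum_ge0.
- exact: nsummable_pair2.
- exact: nsummable_pair2.
Qed.

Lemma rsum_reindex (T1 T2 : choiceType) (e : T1 -> T2) (h : T2 -> R) :
  bijective e -> rsum setT h = rsum setT (h \o e).
Proof. by move=> eb; rewrite /rsum !(esum_reindexT _ eb). Qed.

Lemma rsum1 T (a : T) (h : T -> R) : (forall x, x != a -> h x = 0) ->
  rsum setT h = h a.
Proof.
move=> h0; have E (p : T -> R) : (forall x, 0 <= p x) ->
    (forall x, x != a -> p x = 0) -> nsum p = p a.
  move=> p0 pa; rewrite /nsum [X in fine X](_ : _ = (p a)%:E)//.
  rewrite -(@esum_set1 _ _ a (fun x => (p x)%:E)) ?lee_fin//.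
  rewrite [RHS]esum_mkcond; apply: eq_esum => x _.
  have [->|xa] := eqVneq x a; first by rewrite mem_set.
  by rewrite memNset ?pa//; exact/eqP.
rewrite rsumE !E.
- by rewrite -posnegE.
- exact: funrneg_ge0.
- by move=> x /h0 hx; rewrite /funrneg hx oppr0 maxxx.
- exact: funrpos_ge0.
- by move=> x /h0 hx; rewrite /funrpos hx maxxx.
Qed.

End RealSum.

Section ComplexSum.
Variable R : realType.
Implicit Types (T : choiceType).
Local Notation C := R[i].
Import Normc.

Definition csummable T (h : T -> C) : Prop := nsummable (fun x => normc (h x)).

Lemma normc_ge0 (z : C) : 0 <= normc z.
Proof. by case: z => a b; exact: sqrtr_ge0. Qed.
Hint Resolve normc_ge0 : core.

Lemma normcNE (z : C) : `|z| = (normc z)%:C%C.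
Proof. by rewrite normc_def; case: z. Qed.

Lemma normc_geRe (z : C) : `|complex.Re z| <= normc z.
Proof. by rewrite -lecR -normcNE; exact: normc_ge_Re. Qed.

Lemma normc_geIm (z : C) : `|complex.Im z| <= normc z.
Proof.
case: z => a b /=; rewrite -sqrtr_sqr ler_wsqrtr// lerDr; exact: sqr_ge0.
Qed.

Lemma normc_leReIm (z : C) : normc z <= `|complex.Re z| + `|complex.Im z|.
Proof.
case: z => a b /=.
rewrite -(@ler_pXn2r _ 2) ?nnegrE ?sqrtr_ge0 ?addr_ge0// sqr_sqrtr; last first.
  by rewrite addr_ge0 ?sqr_ge0.
have := mulr_ge0 (normr_ge0 a) (normr_ge0 b).
by rewrite sqrrD !real_normK ?num_real//; lra.
Qed.

Lemma csummable_Re T (h : T -> C) : csummable h ->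
  nsummable (fun x => `|complex.Re (h x)|).
Proof. by apply: nsummable_le => x; exact: normc_geRe. Qed.

Lemma csummable_Im T (h : T -> C) : csummable h ->
  nsummable (fun x => `|complex.Im (h x)|).
Proof. by apply: nsummable_le => x; exact: normc_geIm. Qed.

Lemma csummableD T (h k : T -> C) : csummable h -> csummable k ->
  csummable (fun x => h x + k x).
Proof.
move=> hs ks; apply: nsummable_le (nsummableD _ _ hs ks) => // x.
exact: le_normcD.
Qed.

Lemma csummableZ T c (h : T -> C) : csummable h -> csummable (fun x => c * h x).
Proof.
move=> hs; rewrite /csummable; under eq_fun do rewrite normcM.
exact: nsummableZ.
Qed.

Lemma csum_mkcond T (D : set T) (h : T -> C) :
  csum D h = csum setT (fun x => if x \in D then h x else 0).
Proof.
rewrite /csum rsum_mkcond [in X in Complex _ X]rsum_mkcond.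
by congr Complex; congr rsum; apply/funext => x; case: ifP.
Qed.

Lemma csumD T (h k : T -> C) : csummable h -> csummable k ->
  csum setT (fun x => h x + k x) = csum setT h + csum setT k.
Proof.
move=> hs ks; rewrite /csum.
rewrite -[RHS]/(Complex (_ + _) (_ + _)) 
  -(rsumD (csummable_Re hs) (csummable_Re ks))
  -(rsumD (csummable_Im hs) (csummable_Im ks)).
by congr Complex; congr rsum; apply/funext => x; case: (h x); case: (k x).
Qed.

Lemma csumZ T c (h : T -> C) : csummable h ->
  csum setT (fun x => c * h x) = c * csum setT h.
Proof.
move=> hs; have hR := csummable_Re hs; have hI := csummable_Im hs.
have sZ (d : R) (k : T -> R) : nsummable (fun x => `|k x|) ->
    nsummable (fun x => `|d * k x|).
  by move=> ks; under eq_fun do rewrite normrM; exact: nsummableZ.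
case: c => a b; rewrite /csum.
pose hr x := complex.Re (h x); pose hi x := complex.Im (h x).
have -> : Complex a b * Complex (rsum setT hr) (rsum setT hi) =
    Complex (a * rsum setT hr - b * rsum setT hi)
            (a * rsum setT hi + b * rsum setT hr) :> C by [].
rewrite -(rsumZ a hR) -(rsumZ b hI) -(rsumZ a hI) -(rsumZ b hR) -rsumN.
have hbI : nsummable (fun x => `|- (b * hi x)|).
  by under eq_fun do rewrite normrN; exact: sZ.
rewrite -(rsumD (sZ a _ hR) hbI) -(rsumD (sZ a _ hI) (sZ b _ hR)).
by congr Complex; congr rsum; apply/funext => x; rewrite /hr /hi; case: (h x).
Qed.

Lemma normc_csum T (h : T -> C) : csummable h ->
  normc (csum setT h) <= nsum (fun x => normc (h x)).
Proof.
move=> hs; set z := csum _ _.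
have [->|z0] := eqVneq z 0; first by rewrite normc0 nsum_ge0.
have nz0 : normc z != 0 by apply: contra z0 => /eqP/eq0_normc ->.
pose c := (normc z)%:C%C / z.
have cz : c * z = (normc z)%:C%C by rewrite mulfVK.
have nc : normc c = 1.
  by apply: (mulIf nz0); rewrite mul1r -normcM cz /= expr0n/= addr0 sqrtr_sqr
    ger0_norm.
have -> : normc z = complex.Re (c * z) by rewrite cz.
rewrite -(csumZ c hs).
rewrite (le_trans (ler_norm _))//.
have chs : csummable (fun x => c * h x) by exact: csummableZ.
rewrite (le_trans (rsum_norm (csummable_Re chs)))//.
apply: nsum_le => // x; rewrite (le_trans (normc_geRe _))//.
by rewrite normcM nc mul1r.
Qed.

Lemma csummable_pair1 (T1 T2 : choiceType) (h : T1 * T2 -> C) : csummable h ->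
  forall x, csummable (fun y => h (x, y)).
Proof. by move=> hs x; exact: (nsummable_pair1 _ hs). Qed.

Lemma csummable_pair2 (T1 T2 : choiceType) (h : T1 * T2 -> C) : csummable h ->
  csummable (fun x => csum setT (fun y => h (x, y))).
Proof.
move=> hs; apply: nsummable_le (nsummable_pair2 _ hs) => // x.
exact/normc_csum/csummable_pair1.
Qed.

Lemma csum_pair (T1 T2 : choiceType) (h : T1 * T2 -> C) : csummable h ->
  csum setT h = csum setT (fun x => csum setT (fun y => h (x, y))).
Proof.
by move=> hs; rewrite /csum (rsum_pair (csummable_Re hs))
  (rsum_pair (csummable_Im hs)).
Qed.

Lemma csum_reindex (T1 T2 : choiceType) (e : T1 -> T2) (h : T2 -> C) :
  bijective e -> csum setT h = csum setT (h \o e).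
Proof. by move=> eb; rewrite /csum !(rsum_reindex _ eb). Qed.

Lemma swap_bij (T1 T2 : choiceType) : bijective (fun z : T1 * T2 => (z.2, z.1)).
Proof. by exists (fun z => (z.2, z.1)) => -[]. Qed.

Lemma csummable_reindex (T1 T2 : choiceType) (e : T1 -> T2) (h : T2 -> C) :
  bijective e -> csummable h -> csummable (h \o e).
Proof. by move=> eb; rewrite /csummable /nsummable (esum_reindexT _ eb). Qed.

Lemma csum_exchange (T1 T2 : choiceType) (h : T1 -> T2 -> C) :
  csummable (fun z => h z.1 z.2) ->
  csum setT (fun x => csum setT (h x)) =
  csum setT (fun y => csum setT (fun x => h x y)).
Proof.
move=> hs; have := csum_pair hs => /= <-.
rewrite (csum_reindex _ (swap_bij T2 T1)) csum_pair//.
exact: (csummable_reindex (swap_bij T2 T1)).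
Qed.

Lemma csum1 T (a : T) (h : T -> C) : (forall x, x != a -> h x = 0) ->
  csum setT h = h a.
Proof.
move=> h0; rewrite /csum !(@rsum1 _ _ a); first by case: (h a).
  by move=> x /h0 ->.
by move=> x /h0 ->.
Qed.

End ComplexSum.

Section Ell1.
Variables (R : realType) (S : choiceType).
Local Notation C := R[i].
Import Normc.

Definition ell1_pred : {pred S -> C} := [pred f | `[< csummable f >]].

Lemma ell1_pred_submod : submod_closed ell1_pred.
Proof.
split.
  apply/asboolP; rewrite /csummable /nsummable esum1 ?ltry// => s _.
  by rewrite normc0.
move=> k f g /asboolP fs /asboolP gs; apply/asboolP.
exact: (csummableD (csummableZ k fs) gs).
Qed.

HB.instance Definition _ :=
  GRing.isSubmodClosed.Build C (S -> C) ell1_pred ell1_pred_submod.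

Record ell1 := Ell1 { ell1_val :> S -> C; _ : ell1_val \in ell1_pred }.

HB.instance Definition _ := [isSub for ell1_val].
HB.instance Definition _ := [Choice of ell1 by <:].
HB.instance Definition _ := [SubChoice_isSubLmodule of ell1 by <:].

Implicit Types f g : ell1.

Lemma ell1_summable f : csummable f.
Proof. by case: f => f /= /asboolP. Qed.

Lemma ell1_ext f g : (forall s, f s = g s) -> f = g.
Proof. by move=> fg; apply/val_inj/funext. Qed.

Definition ell1_rnorm f : R := nsum (fun s => normc (f s)).

Lemma ell1_norm_ge f s : normc (f s) <= ell1_rnorm f.
Proof.
apply: (@nsum_ge _ _ (fun s => normc (f s)) s) => [t|]; first exact: normc_ge0.
exact: ell1_summable.
Qed.

(* In a normed R[i]-module the norm takes its values in R[i]. *)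
Definition ell1_norm f : C := (ell1_rnorm f)%:C%C.

Lemma ell1_normD f g : ell1_norm (f + g) <= ell1_norm f + ell1_norm g.
Proof.
have n0 (h : ell1) s : 0 <= normc (h s) by exact: normc_ge0.
have fs := ell1_summable f; have gs := ell1_summable g.
rewrite -rmorphD lecR /ell1_rnorm -(nsumD (n0 f) (n0 g) fs gs).
apply: nsum_le (nsummableD (n0 f) (n0 g) fs gs) => s; first exact: n0.
exact: le_normcD.
Qed.

Lemma ell1_normZ (k : C) f : ell1_norm (k *: f) = `|k| * ell1_norm f.
Proof.
have n0 s : 0 <= normc (f s) by exact: normc_ge0.
rewrite normcNE -rmorphM /ell1_norm /ell1_rnorm.
rewrite -(nsumZ (normc_ge0 k) n0 (ell1_summable f)).
by congr (nsum _)%:C%C; apply/funext => x; rewrite -normcM.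
Qed.

Lemma ell1_norm0_eq0 f : ell1_norm f = 0 -> f = 0.
Proof.
move=> /(@complexI R) f0; apply: ell1_ext => s; apply: eq0_normc.
by apply/eqP; rewrite eq_le normc_ge0 andbT -f0 ell1_norm_ge.
Qed.

HB.instance Definition _ := Lmodule_isNormed.Build C ell1
  ell1_normD ell1_normZ ell1_norm0_eq0.

Lemma ell1_normE f : `|f| = (ell1_rnorm f)%:C%C.
Proof. by []. Qed.

Lemma ell1_pointwise_limit (F : set_system ell1) : ProperFilter F -> cauchy F ->
  forall s, exists z : C, forall e : R, 0 < e ->
    F [set f : ell1 | normc (f s - z) < e].
Proof.
move=> FF /cauchyP Fc s.
have lim1 (p : C -> R) : (forall x y, p (x - y) = p x - p y) ->
    (forall x, `|p x| <= normc x) ->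
    exists l : R, forall e : R, 0 < e -> F [set f : ell1 | `|p (f s) - l| < e].
  move=> pB pn.
  have Gc : cauchy ((fun f : ell1 => p (f s)) @ F).
    apply/cauchy_exP => e e0.
    have [//|f0 f0F] := Fc e%:C%C; first by rewrite ltcR.
    exists (p (f0 s)).
    suff : F [set f : ell1 | ball (p (f0 s)) e (p (f s))] by [].
    apply: filterS f0F => f; rewrite -!ball_normE /=.
    rewrite ell1_normE ltcR; apply: le_lt_trans.
    by rewrite -pB (le_trans (pn _))// (ell1_norm_ge (f0 - f) s).
  have /cvg_ex[l Gl] := @R_complete R _ (fmap_proper_filter _ FF) Gc.
  exists l => e e0; move/cvgrPdist_lt : Gl => /(_ e e0).
  by apply: filterS => f; rewrite distrC.
have [a aP] := lim1 (@complex.Re R)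
  (fun x y => raddfB (@complex.Re R : Rcomplex R -> R) x y) (@normc_geRe R).
have [b bP] := lim1 (@complex.Im R)
  (fun x y => raddfB (@complex.Im R : Rcomplex R -> R) x y) (@normc_geIm R).
exists (Complex a b) => e e0; have e20 : 0 < e / 2 by rewrite divr_gt0.
apply: filterS (filterI (aP _ e20) (bP _ e20)) => f [fa fb] /=.
rewrite (le_lt_trans (normc_leReIm _))// (splitr e).
by move: fa fb => /=; case: (f s) => x y /=; exact: ltrD.
Qed.

Lemma ell1_complete (F : set_system ell1) : ProperFilter F -> cauchy F -> cvg F.
Proof.
move=> FF Fc; have [g gP] := choice (ell1_pointwise_limit FF Fc).
have key (e : R) (f0 : ell1) : 0 < e -> F (ball f0 e%:C%C) ->
    csummable (fun s => g s - f0 s) /\ nsum (fun s => normc (g s - f0 s)) <= e.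
  move=> e0 f0F; apply: nsum_le_fset => [s|X]; first exact: normc_ge0.
  apply/ler_addgt0Pr => d d0.
  pose d' := d / (size X).+1%:R; have d'0 : 0 < d' by rewrite divr_gt0.
  have near_g (r : seq S) :
      F [set f : ell1 | forall s, s \in r -> normc (f s - g s) < d'].
    elim: r => [|s r IH]; first by apply: nearW => f t; rewrite in_nil.
    apply: filterS (filterI (gP s _ d'0) IH) => f [fs fr] t.
    by rewrite inE => /predU1P[->|/fr].
  have : F (ball f0 e%:C%C `&`
      [set f : ell1 | forall s, s \in X -> normc (f s - g s) < d']).
    by apply: filterI => //; exact: near_g.
  move=> /filter_ex[f []].
  rewrite -ball_normE /= ell1_normE ltcR => f0f fX.
  apply: (@le_trans _ _ (\sum_(s <- X) (d' + normc ((f0 - f) s)))).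
    rewrite !big_seq; apply: ler_sum => s sX.
    rewrite (_ : g s - f0 s = - (f s - g s) + - (f0 s - f s)); last by ring.
    by rewrite (le_trans (le_normcD _ _))// !normcN lerD// ltW// fX.
  rewrite big_split/= addrC lerD//.
    apply: le_trans (ltW f0f).
    exact: (@nsum_ge_fset R S (fun s => normc ((f0 - f) s)) X
      (fun s => normc_ge0 _) (ell1_summable (f0 - f))).
  rewrite big_const_seq count_predT iter_addr_0 -[leLHS]mulr_natr /d'.
  by rewrite mulrAC ler_pdivrMr// ler_pM2l// ler_nat.
have gs : g \in ell1_pred.
  have [//|f0 f0F] := (cauchyP _).1 Fc (1 : R)%:C%C.
  have [gf0 _] := key 1 f0 ltr01 f0F; apply/asboolP.
  rewrite (_ : g = fun s => (g s - f0 s) + f0 s).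
    by apply: csummableD => //; exact: ell1_summable.
  by apply/funext => s; rewrite subrK.
apply/cvg_ex; exists (Ell1 gs : ell1); apply/cvgrPdist_lt => e e0.
have er : e = (complex.Re e)%:C%C by rewrite RRe_real// gtr0_real.
move: e0; rewrite er ltcR; set d := complex.Re e => d0.
have d20 : 0 < d / 2 by rewrite divr_gt0.
have [//|f0 f0F] := (cauchyP _).1 Fc (d / 2)%:C%C; first by rewrite ltcR.
have [_ gf0] := key _ f0 d20 f0F.
apply: filterS f0F => f; rewrite -ball_normE /= => f0f.
rewrite -(subrK f0 (Ell1 gs : ell1)) -addrA.
rewrite (le_lt_trans (ler_normD _ _))// (splitr d) rmorphD ler_ltD//.
by rewrite ell1_normE lecR.
Qed.

HB.instance Definition _ := Uniform_isComplete.Build ell1 ell1_complete.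

End Ell1.

Section PushForward.
Variables (R : realType) (T S : choiceType) (e : T -> S).
Local Notation C := R[i].
Import Normc.

Lemma csummable_bdd (U : choiceType) (M : R) (phi F : U -> C) :
  (forall u, normc (phi u) <= M) -> csummable F ->
  csummable (fun u => phi u * F u).
Proof.
move=> phiM Fs.
have M0 (u : U) : 0 <= M by exact: le_trans (normc_ge0 _) (phiM u).
apply: (@nsummable_le _ _ _ (fun u => `|M| * normc (F u))).
  move=> u; rewrite normcM ler_wpM2r ?normc_ge0// (le_trans (phiM u))//.
  exact: ler_norm.
by apply: nsummableZ => // u; exact: normc_ge0.
Qed.

Lemma csummable_prod (U V : choiceType) (F : U -> C) (G : V -> C) :
  csummable F -> csummable G -> csummable (fun z : U * V => F z.1 * G z.2).
Proof.
move=> Fs Gs; rewrite /csummable; under eq_fun do rewrite normcM.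
by apply: (nsummable_prod _ _ Fs Gs).1 => u; exact: normc_ge0.
Qed.

Lemma push_swap_summable (p : T -> R) : (forall t, 0 <= p t) -> nsummable p ->
  let q := fun z : S * T => if e z.2 == z.1 then p z.2 else 0 in
  nsummable q /\ nsum q = nsum p.
Proof.
move=> p0 ps q; have q0 z : 0 <= q z by rewrite /q; case: ifP.
suff E : \esum_(z in [set: S * T]) (q z)%:E = \esum_(t in [set: T]) (p t)%:E.
  by rewrite /nsummable /nsum E.
rewrite (esum_reindexT _ (swap_bij T S)) -esum_pair//=.
apply: eq_esum => t _; rewrite -(@esum_set1 _ _ (e t) (fun=> (p t)%:E)) ?lee_fin//.
rewrite [RHS]esum_mkcond; apply: eq_esum => s _.
rewrite /q/= eq_sym; have [->|se] := eqVneq s (e t); first by rewrite mem_set.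
by rewrite memNset//; exact/eqP.
Qed.

Definition push (F : T -> C) (s : S) : C := csum [set t | e t = s] F.

Lemma pushE F s : push F s = csum setT (fun t => if e t == s then F t else 0).
Proof.
rewrite /push csum_mkcond; congr csum; apply/funext => t.
have [ts|ts] := eqVneq (e t) s; first by rewrite mem_set.
by rewrite memNset//; exact/eqP.
Qed.

Lemma push_kernel_summable (F : T -> C) : csummable F ->
  let h := fun z : S * T => if e z.2 == z.1 then F z.2 else 0 in
  csummable h /\ nsum (fun z => normc (h z)) = nsum (fun t => normc (F t)).
Proof.
move=> Fs h; have := push_swap_summable (fun t => normc_ge0 (F t)) Fs.
rewrite (_ : (fun z : S * T => _) = (fun z => normc (h z))) //.
by apply/funext => z; rewrite /h; case: ifP => // _; rewrite normc0.
Qed.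

Lemma push_summable (F : T -> C) : csummable F -> csummable (push F) /\
  nsum (fun s => normc (push F s)) <= nsum (fun t => normc (F t)).
Proof.
move=> Fs; have [hs hE] := push_kernel_summable Fs.
have n0 (z : S * T) : 0 <= normc (if e z.2 == z.1 then F z.2 else 0).
  exact: normc_ge0.
have pE : push F = fun s => csum setT (fun t => if e t == s then F t else 0).
  by apply/funext => s; rewrite pushE.
split; first by rewrite pE; exact: (csummable_pair2 hs).
rewrite -hE (nsum_pair n0 hs); apply: nsum_le (nsummable_pair2 n0 hs) => s.
  exact: normc_ge0.
by rewrite pE; exact: (normc_csum (csummable_pair1 hs s)).
Qed.

Lemma csum_push (M : R) (phi : S -> C) (F : T -> C) :
  (forall s, normc (phi s) <= M) -> csummable F ->
  csum setT (fun s => phi s * push F s) = csum setT (fun t => phi (e t) * F t).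
Proof.
move=> phiM Fs; have [hs _] := push_kernel_summable Fs.
have ks := csummable_bdd (fun z : S * T => phiM z.1) hs.
have E := @csum_exchange R S T
  (fun s t => phi s * (if e t == s then F t else 0)) ks.
transitivity (csum setT (fun s => csum setT (fun t =>
    phi s * (if e t == s then F t else 0)))).
  congr csum; apply/funext => s; rewrite pushE csumZ//.
  exact: (csummable_pair1 hs s).
rewrite E; congr csum; apply/funext => t; rewrite (csum1 (a := e t)) ?eqxx//.
by move=> s st; rewrite eq_sym (negPf st) mulr0.
Qed.

End PushForward.

Section Convolution.
Variables (R : realType) (S : semigroupType).
Local Notation C := R[i].
Local Notation ell1 := (ell1 R S).
Import Normc.
Implicit Types f g h : ell1.

Definition convol_fun (f g : S -> C) (u : S) : C :=
  csum [set p : S * S | (p.1 * p.2)%g = u] (fun p => f p.1 * g p.2).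

Local Notation mulp := (fun p : S * S => (p.1 * p.2)%g).

Lemma convol_funE (f g : S -> C) :
  convol_fun f g = push mulp (fun p => f p.1 * g p.2).
Proof. by []. Qed.

Lemma tensor_summable f g : csummable (fun p : S * S => f p.1 * g p.2).
Proof. exact: csummable_prod (ell1_summable f) (ell1_summable g). Qed.

Lemma convol_subproof f g : convol_fun f g \in @ell1_pred R S.
Proof. exact/asboolP/(push_summable mulp (tensor_summable f g)).1. Qed.

Definition convol f g : ell1 := Ell1 (convol_subproof f g).

Lemma convol_norm f g : `|convol f g| <= `|f| * `|g|.
Proof.
rewrite !ell1_normE -rmorphM lecR.
rewrite (le_trans (push_summable mulp (tensor_summable f g)).2)//.
have n0 (k : ell1) s : 0 <= normc (k s) by exact: normc_ge0.
rewrite -(nsummable_prod (n0 f) (n0 g) (ell1_summable f) (ell1_summable g)).2.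
by rewrite le_eqVlt; apply/orP; left; apply/eqP; congr nsum; apply/funext => p;
  rewrite normcM.
Qed.

Lemma csummable_if (T : choiceType) (D : pred T) (F : T -> C) : csummable F ->
  csummable (fun t => if D t then F t else 0).
Proof.
by apply: nsummable_le => t; case: ifP => // _; rewrite normc0 normc_ge0.
Qed.

Lemma push_linear (F G : S * S -> C) k u : csummable F -> csummable G ->
  push mulp (fun p => k * F p + G p) u = k * push mulp F u + push mulp G u.
Proof.
move=> Fs Gs; rewrite !pushE.
have Fs' := csummable_if (fun p => mulp p == u) Fs.
have Gs' := csummable_if (fun p => mulp p == u) Gs.
rewrite -(csumZ k Fs') -(csumD (csummableZ k Fs') Gs').
by congr csum; apply/funext => p; case: ifP => // _; rewrite mulr0 addr0.
Qed.

Lemma convol_linearl g : linear (convol^~ g).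
Proof.
move=> k f1 f2; apply: ell1_ext => u.
rewrite -[RHS]/(k * convol_fun f1 g u + convol_fun f2 g u) -[LHS]/(convol_fun _ g u).
rewrite !convol_funE -(push_linear _ _ (tensor_summable f1 g) (tensor_summable f2 g)).
congr push; apply/funext => p.
by rewrite -[(k *: f1 + f2) p.1]/(k * f1 p.1 + f2 p.1) mulrDl mulrA.
Qed.

Lemma convol_linearr f : linear (convol f).
Proof.
move=> k g1 g2; apply: ell1_ext => u.
rewrite -[RHS]/(k * convol_fun f g1 u + convol_fun f g2 u) -[LHS]/(convol_fun f _ u).
rewrite !convol_funE -(push_linear _ _ (tensor_summable f g1) (tensor_summable f g2)).
congr push; apply/funext => p.
by rewrite -[(k *: g1 + g2) p.2]/(k * g1 p.2 + g2 p.2) mulrDr mulrCA.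
Qed.

Lemma csum_convol (M : R) (phi : S -> C) f g : (forall s, normc (phi s) <= M) ->
  csum setT (fun u => phi u * convol f g u) =
  csum setT (fun p : S * S => phi (p.1 * p.2)%g * (f p.1 * g p.2)).
Proof.
by move=> phiM; rewrite (csum_push mulp phiM (tensor_summable f g)).
Qed.

Lemma convolA : associative convol.
Proof.
move=> f g h; apply: ell1_ext => w.
pose phi (u : S) : C := (u == w)%:R.
have phiM u : normc (phi u) <= 1.
  by rewrite /phi; case: eqP; rewrite ?normc1 ?normc0 ?ler01.
have ev (k : ell1) : k w = csum setT (fun u => phi u * k u).
  rewrite (csum1 (a := w)) /phi ?eqxx ?mul1r// => x /negPf ->.
  by rewrite mul0r.
pose K (z : S * (S * S)) :=
  phi (z.1 * (z.2.1 * z.2.2))%g * (f z.1 * (g z.2.1 * h z.2.2)).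
have Ks : csummable K.
  apply: (csummable_bdd (fun z => phiM _)).
  exact: csummable_prod (ell1_summable f) (tensor_summable g h).
transitivity (csum setT K).
  have B z := phiM (mulp z).
  rewrite ev (csum_convol _ _ phiM) csum_pair/=; last first.
    exact: (csummable_bdd B (tensor_summable f (convol g h))).
  rewrite csum_pair//; congr csum; apply/funext => s.
  under eq_fun do rewrite mulrCA.
  have As : csummable (fun t => phi (s * t)%g * convol g h t).
    exact: csummable_bdd (fun t => phiM _) (ell1_summable _).
  rewrite csumZ// (csum_convol _ _ (fun t => phiM (s * t)%g)) -csumZ.
    by congr csum; apply/funext => q; rewrite /K/= mulrCA.
  exact: csummable_bdd (fun t => phiM _) (tensor_summable g h).
have eb : bijective (fun z : S * (S * S) => (z.2.1, (z.2.2, z.1))).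
  by exists (fun z => (z.2.2, (z.1, z.2.1))) => -[? [? ?]].
rewrite (csum_reindex K eb) ev (csum_convol _ _ phiM).
have Hs := csummable_bdd (fun z => phiM (mulp z))
  (tensor_summable (convol f g) h).
rewrite (csum_reindex _ (swap_bij S S)).
rewrite (csum_pair (csummable_reindex (swap_bij S S) Hs)) /=.
rewrite (csum_pair (csummable_reindex eb Ks)) /=.
congr csum; apply/funext => t.
under [in RHS]eq_fun do rewrite mulrA mulrC.
have As : csummable (fun v => phi (v * t)%g * convol f g v).
  exact: csummable_bdd (fun t => phiM _) (ell1_summable _).
rewrite csumZ// (csum_convol _ _ (fun v => phiM (v * t)%g)) -csumZ.
  by congr csum; apply/funext => q; rewrite /K/= mulgA; ring.
exact: csummable_bdd (fun t => phiM _) (tensor_summable f g).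
Qed.

Lemma convolDl : left_distributive convol +%R.
Proof. by move=> f g h; have := convol_linearl h 1 f g; rewrite !scale1r. Qed.

Lemma convolDr : right_distributive convol +%R.
Proof. by move=> f g h; have := convol_linearr f 1 g h; rewrite !scale1r. Qed.

Lemma convol_scalerAl k f g : k *: convol f g = convol (k *: f) g.
Proof.
have c0 : convol 0 g = 0 by apply: (addrI (convol 0 g)); rewrite -convolDl !addr0.
by have := convol_linearl g k f 0; rewrite !addr0 c0 addr0 => ->.
Qed.

Lemma convol_scalerAr k f g : k *: convol f g = convol f (k *: g).
Proof.
have c0 : convol f 0 = 0 by apply: (addrI (convol f 0)); rewrite -convolDr !addr0.
by have := convol_linearr f k g 0; rewrite !addr0 c0 addr0 => ->.
Qed.

HB.instance Definition _ := CompleteNormedModule_isBanachAlgebra.Build C ell1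
  convolA convolDl convolDr convol_scalerAl convol_scalerAr convol_norm.

End Convolution.

(* Main.v *)
(* A bounded cochain on l^1(S) is a bounded function on cyclic words
   (x_0, ..., x_n) of S, so it suffices to contract, with bounds depending only on
   n, the complex of bounded functions on words.

   Preorder S by x <= y iff xyx = x; its classes are the D-classes, which are
   rectangular bands, and products are meets of classes. The faces of a word
   preserve the class of its total product. On the words whose first letter
   already lies in that class, splitting x_0 as (x_0 e)(e x_0), for a chosen e in
   the class, is a contraction; so a cocycle is cohomologous to one vanishing on
   these words. For the others, let g represent the class of x_0 and
   q_i = x_(i+1) ... x_n x_0 g. The alternating sum of the words
   (x_0, ..., x_i, q_i, q_i, q_(i+1), ..., q_(n-1)) is a homotopy from the identity
   to a map into the words already treated, up to words whose first letter is
   strictly below x_0. Each use of it thus makes the cocycle vanish one step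
   higher. In the semilattice generated by the n+1 letters of a word a strictly
   descending chain has bounded length, so n+2 uses make the cocycle zero. *)

Require Import Defs.
From mathcomp Require Import all_boot all_order all_algebra reals.
From mathcomp Require Import boolp classical_sets ereal esum.
From mathcomp Require Import finmap complex zify ring lra.

Set Implicit Arguments.
Unset Strict Implicit.
Unset Printing Implicit Defensive.

Import Order.TTheory GRing.Theory Num.Theory.

(** * Bands and faces of cyclic words *)

Section Band.
Local Open Scope group_scope.
Variables (S : semigroupType) (bandS : forall s : S, s * s = s).
Implicit Types x y z u v : S.

Definition band_le x y := x * y * x == x.

Lemma band_leE x y : band_le x y -> x * y * x = x.
Proof. by move/eqP. Qed.

(** So the preorder is containment of principal ideals. With [t = x * u * y] idempotency gives
    [t * v = x], hence [t * x = x], that is [x = (x * u) * (y * x)]; one more factor [y * x] on the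
    right changes nothing. *)
Lemma band_le_factor x y u v : x = u * y * v -> band_le x y.
Proof.
move=> xE; pose t := x * u * y.
have tv : t * v = x by rewrite /t -mulgA -mulgA [u * _]mulgA -xE bandS.
have tx : x = (x * u) * (y * x).
  by rewrite mulgA -/t -{2}tv mulgA bandS tv.
by apply/eqP; rewrite -mulgA {1}tx -mulgA bandS -tx.
Qed.

Lemma band_le_refl x : band_le x x.
Proof. by rewrite /band_le !bandS. Qed.

Lemma band_le_trans y x z : band_le x y -> band_le y z -> band_le x z.
Proof.
move=> /band_leE xy /band_leE yz; apply: (@band_le_factor _ _ (x * y) (y * x)).
by rewrite -{1}xy -{1}yz !mulgA.
Qed.

Lemma band_le_mull x y : band_le (x * y) x.
Proof.
by apply: (@band_le_factor _ _ x y); rewrite bandS.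
Qed.

Lemma band_le_mulr x y : band_le (x * y) y.
Proof.
by apply: (@band_le_factor _ _ x y); rewrite -mulgA bandS.
Qed.

(** Write [z = z * (y * z * x) * z] and square the idempotent in the middle: the factor [x * y]
    appears. *)
Lemma band_le_meet z x y : band_le z x -> band_le z y -> band_le z (x * y).
Proof.
move=> /band_leE zx /band_leE zy.
apply: (@band_le_factor _ _ (z * y * z) (z * x * z)).
have zE : z = z * (y * z * x) * z by rewrite !mulgA zy zx.
by rewrite {1}zE -[y * z * x]bandS !mulgA.
Qed.

(** As [z] lies below [x * y], it may be replaced by [z * x * y * z] in [x * z]; then [x * z * x]
    collapses to [x]. *)
Lemma band_rect x y z :
  band_le x z -> band_le z x -> band_le z y -> x * y * z = x * z.
Proof.
move=> /band_leE xz zx zy.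
have zxyz := band_leE (band_le_meet zx zy).
by rewrite -[in RHS]zxyz !mulgA xz.
Qed.

Definition band_eq x y := band_le x y && band_le y x.

(** [choose] gives one element per class: the homotopies need the same representative for a word and
    for its faces. *)
Definition band_rep x := choose (band_eq x) x.

Lemma band_eq_rep x : band_eq x (band_rep x).
Proof. by apply: (@chooseP _ (band_eq x)); rewrite /band_eq band_le_refl. Qed.

Lemma band_le_rep x : band_le x (band_rep x).
Proof. by case/andP: (band_eq_rep x). Qed.

Lemma band_rep_le x : band_le (band_rep x) x.
Proof. by case/andP: (band_eq_rep x). Qed.

Lemma eq_band_rep x y : band_le x y -> band_le y x -> band_rep x = band_rep y.
Proof.
move=> xy yx; have e : band_eq x =1 band_eq y.
  move=> z; apply/andP/andP => -[h1 h2]; split.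
  - exact: band_le_trans yx h1.
  - exact: band_le_trans h2 xy.
  - exact: band_le_trans xy h1.
  - exact: band_le_trans h2 yx.
rewrite /band_rep (eq_choose e); apply: choose_id; rewrite -?e /band_eq.
  by rewrite band_le_refl.
by rewrite xy yx.
Qed.

End Band.

Ltac resolve_ifs := repeat match goal with
  | |- context [if ?b then _ else _] =>
    first [have -> : b = true by lia | have -> : b = false by lia]
  end.

Section Words.
Variable S : semigroupType.
Implicit Types x y : nat -> S.

(* A cyclic word (x_0, ..., x_n) is given by any sequence with these first
   letters. The letter x_0 is the argument of the functional in A', and
   x_1, ..., x_n are the arguments of the cochain. *)
Definition face n j x : nat -> S := fun k =>
  if (j < n)%N then
    if (k < j)%N then x k else if k == j then (x j * x j.+1)%g else x k.+1
  else if k == 0%N then (x n * x 0%N)%g else x k.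

Lemma face_ext n j x y : (forall k, (k <= n)%N -> x k = y k) ->
  forall k, (k < n)%N -> face n j x k = face n j y k.
Proof.
move=> xy k kn; rewrite /face; case: ifP => jn.
  by case: ifP => kj; [|case: ifP => kj']; rewrite ?xy //; lia.
by case: ifP => k0; rewrite !xy //; lia.
Qed.

(** The simplicial identities. Where the two faces meet, cyclically included, they express
    associativity. *)
Lemma face_face n i j x : (i < j)%N -> (j <= n.+2)%N ->
  forall k, (k <= n)%N ->
  face n.+1 i (face n.+2 j x) k = face n.+1 j.-1 (face n.+2 i x) k.
Proof.
move=> ij jn k kn; rewrite /face.
have [jn2|jn2] : (j < n.+2)%N \/ j = n.+2 by lia.
  have [ki|ik|->] := ltngtP k i; first by resolve_ifs.
    have [kj|jk|kj] := ltngtP k j.-1; [by resolve_ifs..|].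
    by resolve_ifs; do 2?f_equal; lia.
  have [ij'|ij'] : (i < j.-1)%N \/ i = j.-1 by lia.
    by resolve_ifs.
  by resolve_ifs; rewrite mulgA; do 3?f_equal; lia.
subst j; rewrite /=.
have [->|k0] := posnP k.
  have [->|i0] := posnP i; resolve_ifs; first by rewrite mulgA.
  have [in1|in1] : (i < n.+1)%N \/ i = n.+1 by lia.
    by resolve_ifs.
  by rewrite in1; resolve_ifs; rewrite mulgA.
have [ki|ik|ki] := ltngtP k i; [|by resolve_ifs|by subst i; resolve_ifs].
by case: (ltnP i n.+1) => ?; resolve_ifs.
Qed.

End Words.

(** * Cancellation in alternating double sums *)

Section DoubleSums.
Variable (R : pzRingType).
Local Open Scope ring_scope.

(** The triangles below and above the two diagonals [j = i] and [j = i.+1] are shifted onto one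
    index rectangle, ready to cancel. *)
Lemma double_sum_split n (a : nat -> nat -> R) :
  \sum_(i < n.+1) \sum_(j < n.+2) a i j =
  \sum_(i < n) \sum_(j < n.+1) a i.+1 j *+ (j <= i)
  + \sum_(i < n) \sum_(j < n.+1) a i j.+1 *+ (i < j)
  + \sum_(i < n.+1) (a i i + a i i.+1).
Proof.
have E (i : 'I_n.+1) : \sum_(j < n.+2) a i j = \sum_(j < n.+2) a i j *+ (j < i)
   + \sum_(j < n.+2) a i j *+ (i.+1 < j) + (a i i + a i i.+1).
  have -> : a i i = \sum_(j < n.+2) a i j *+ (j == i :> nat).
    by rewrite (bigD1 (widen_ord (leqnSn _) i)) //= eqxx big1 ?addr0 // => j;
      rewrite -val_eqE /= => /negPf ->.
  have -> : a i i.+1 = \sum_(j < n.+2) a i j *+ (j == i.+1 :> nat).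
    by rewrite (bigD1 (lift ord0 i)) //= eqxx big1 ?addr0 // => j;
      rewrite -val_eqE /= => /negPf ->.
  rewrite -!big_split /=; apply: eq_bigr => j _.
  rewrite -!mulrnDr; have -> : ((j < i) + (i.+1 < j) +
      ((j == i :> nat) + (j == i.+1 :> nat)) = 1)%N by lia.
  by [].
rewrite (eq_bigr _ (fun i _ => E i)) !big_split /=; congr (_ + _ + _).
  rewrite big_ord_recl big1 ?add0r => [|j _]; last by rewrite ltn0.
  apply: eq_bigr => i _; rewrite big_ord_recr /= /bump leq0n add1n.
  by rewrite ltnNge ltnW ?addr0 // ltnS.
rewrite big_ord_recr /= [X in _ + X]big1 ?addr0 => [|j _]; last first.
  by rewrite ltnNge -ltnS ltn_ord.
apply: eq_bigr => i _; rewrite big_ord_recl /= add0r.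
by apply: eq_bigr => j _.
Qed.

Lemma face_sum0 n (a : nat -> nat -> R) :
  (forall i j, (i < j)%N -> (j < n.+2)%N -> a i j = a j.-1 i) ->
  \sum_(i < n.+1) \sum_(j < n.+2) (-1) ^+ (i + j) * a i j = 0.
Proof.
move=> aE; rewrite (double_sum_split _ (fun i j => (-1) ^+ (i + j) * a i j)).
rewrite [X in _ + X]big1 ?addr0 => [|i _]; last first.
  by rewrite addnS exprS mulN1r mulNr (aE i i.+1) ?subrr // ltnS ltn_ord.
rewrite exchange_big big_ord_recr /= [X in _ + X + _]big1 ?addr0 => [|i _]; last first.
  by rewrite leqNgt ltn_ord.
rewrite -big_split big1 //= => i _; rewrite big_ord_recl /= add0r -big_split.
rewrite big1 //= => j _; rewrite /bump !leq0n !add1n !ltnS.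
case: leqP => ij; rewrite ?addr0 // !mulr1n (aE i j.+2) ?ltnS //; last exact: ltnW.
by rewrite /= !addSn !addnS !exprS !mulN1r opprK addnC mulNr addNr.
Qed.

(* To be read with a i j = d_j s_i and b i j = s_i d_j for a simplicial homotopy
   s; these identities make the double sums telescope. *)
Lemma prism_sum n (a b : nat -> nat -> R) :
  (forall i j, (j <= i < n)%N -> a i.+1 j = b i j) ->
  (forall i j, (i < j <= n)%N -> a i j.+1 = b i j) ->
  (forall i, (i < n)%N -> a i.+1 i.+1 = a i i.+1) ->
  \sum_(i < n.+1) \sum_(j < n.+2) (-1) ^+ (i + j) * a i j
  + \sum_(i < n) \sum_(j < n.+1) (-1) ^+ (i + j) * b i j
  = a 0%N 0%N - a n n.+1.
Proof.
move=> ab1 ab2 aa; rewrite (double_sum_split _ (fun i j => (-1) ^+ (i + j) * a i j)).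
rewrite addrC addrA -[RHS]add0r; congr (_ + _).
  rewrite -!big_split big1 //= => i _; rewrite -!big_split big1 //= => j _.
  have ? := ltn_ord i; have ? := ltn_ord j.
  rewrite addSn addnS !exprS !mulN1r; have [ji|ij] := leqP j i.
    by rewrite ab1 ?mulr1n ?mulr0n ?addr0 ?mulNr ?subrr //; lia.
  by rewrite ab2 ?mulr1n ?mulr0n ?add0r ?mulNr ?subrr //; lia.
rewrite big_split /= big_ord_recl [X in _ + X]big_ord_recr /=.
have sgn k : (-1) ^+ (k + k) = 1 :> R by rewrite addnn -signr_odd odd_double.
rewrite addn0 addnS exprS sgn !mul1r mulN1r mulNr mul1r addrACA -addrA.
rewrite addrC -addrA -[RHS]addr0 addrA addr0 addrA -big_split.
rewrite big1 ?add0r 1?addrC //= => i _.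
by rewrite /bump !leq0n !add1n sgn addnS exprS sgn mulr1 mulN1r mul1r aa // addNr.
Qed.

End DoubleSums.

(** * The two homotopies *)

Section Prism.
Local Open Scope group_scope.
Variables (S : semigroupType) (bandS : forall s : S, s * s = s).
Implicit Types x y : nat -> S.

(* The words whose first letter lies in the D-class of the product of all the
   letters. *)
Definition bottom n x := forall k, (k <= n)%N -> band_le (x 0%N) (x k).

(* The word x_(i+1) ... x_n x_0 g, where g represents the D-class of x_0. Since
   x_0 g x_0 = x_0, the last face of a word ending in x_0 g returns x_0. *)
Definition tailp n x i :=
  foldr *%g (x 0%N * band_rep (x 0%N)) [seq x k | k <- iota i.+1 (n - i)].

Lemma tailp_n n x : tailp n x n = x 0%N * band_rep (x 0%N).
Proof. by rewrite /tailp subnn. Qed.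

Lemma tailpS n x i : (i < n)%N -> tailp n x i = x i.+1 * tailp n x i.+1.
Proof. by move=> i_n; rewrite /tailp -(subnSK i_n). Qed.

Lemma tailp_absorb n x i : (i < n)%N ->
  tailp n x i * tailp n x i.+1 = tailp n x i.
Proof. by move=> i_n; rewrite tailpS // -mulgA bandS. Qed.

Lemma tailp_ind n x (P : S -> Prop) :
  P (x 0%N * band_rep (x 0%N)) ->
  (forall k (s : S), (k < n)%N -> P s -> P (x k.+1 * s)) ->
  forall i, (i <= n)%N -> P (tailp n x i).
Proof.
move=> P0 PS i i_n; rewrite -(subKn i_n); elim: (n - i)%N (leq_subr i n) => [|m IH] mn.
  by rewrite subn0 tailp_n.
rewrite tailpS; last by lia.
apply: PS; first by lia.
by rewrite -subSn // subSS; apply: IH; exact: ltnW.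
Qed.

Lemma face_lt n j x k : (k < j < n)%N -> face n j x k = x k.
Proof. by case/andP => kj jn; rewrite /face jn kj. Qed.

Lemma face_eq n j x : (j < n)%N -> face n j x j = x j * x j.+1.
Proof. by move=> jn; rewrite /face jn ltnn eqxx. Qed.

Lemma face_gt n j x k : (j < k)%N -> (j < n)%N -> face n j x k = x k.+1.
Proof. by move=> jk jn; rewrite /face jn ltnNge ltnW //= gtn_eqF. Qed.

Lemma face_last n x k : (0 < k)%N -> face n n x k = x k.
Proof. by move=> k0; rewrite /face ltnn gtn_eqF. Qed.

Lemma face_last0 n x : face n n x 0%N = x n * x 0%N.
Proof. by rewrite /face ltnn. Qed.

(** The second hypothesis keeps the class of [x 0], hence its representative; the face then merely
    omits the [j]-th tail product. *)
Lemma tailp_face n j x : (j <= n.+1)%N ->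
  band_le (x 0%N) (face n.+1 j x 0%N) -> forall i, (i <= n)%N ->
  tailp n (face n.+1 j x) i = if (i < j)%N then tailp n.+1 x i else tailp n.+1 x i.+1.
Proof.
move=> jn xy i i_n; rewrite -(subKn i_n).
elim: (n - i)%N (leq_subr i n) => [_|m IH mn].
  rewrite subn0 tailp_n; have [jE|jn1] := eqVneq j n.+1.
    move: xy; rewrite jE ltnSn face_last0 => xy; rewrite tailpS // tailp_n.
    rewrite (@eq_band_rep _ bandS _ (x 0%N)) ?mulgA //.
    exact: band_le_mulr.
  rewrite ltnNge -ltnS ltn_neqAle jn1 jn /= tailp_n; case: j jn jn1 xy => [|j] jn jn1 xy.
    rewrite face_eq // in xy *.
    rewrite (@eq_band_rep _ bandS _ (x 0%N)) ?band_le_mull //.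
    (* For [j = 0], the letter [x 1] is absorbed between [x 0] and the representative. *)
    apply: band_rect (band_le_rep bandS _) (band_rep_le bandS _) _ => //.
    apply: (band_le_trans bandS) (band_rep_le bandS _) _.
    exact: (band_le_trans bandS) xy (band_le_mulr bandS _ _).
  by rewrite face_lt //; lia.
set k := (n - m.+1)%N; have kE : (n - m)%N = k.+1 by rewrite /k; lia.
have k_n : (k < n)%N by rewrite /k; lia.
rewrite tailpS // -kE IH //; last exact: ltnW.
rewrite kE; have [k1j|jk1|jE] := ltngtP k.+1 j.
- rewrite [RHS]tailpS //; last by lia.
  congr (_ * _); have [->|jn1] := eqVneq j n.+1; first by rewrite face_last.
  by rewrite face_lt //; lia.
- by rewrite [RHS]tailpS ?face_gt //; lia.
- rewrite -jE (@tailpS n.+1 _ k) 1?(@tailpS n.+1 _ k.+1) ?mulgA; try by lia.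
  by rewrite face_eq //; lia.
Qed.

(* With q_i = tailp n x i, this is (x_0, ..., x_i, q_i, q_i, q_(i+1), ..., q_(n-1)). *)
Definition prism n i x : nat -> S := fun k =>
  if (k <= i)%N then x k else if k == i.+1 then tailp n x i else tailp n x k.-2.

Lemma prism_le n i x k : (k <= i)%N -> prism n i x k = x k.
Proof. by rewrite /prism => ->. Qed.

Lemma prism_eq n i x : prism n i x i.+1 = tailp n x i.
Proof. by rewrite /prism ltnn eqxx. Qed.

Lemma prism_gt n i x k : (i.+1 < k)%N -> prism n i x k = tailp n x k.-2.
Proof. by move=> ik; rewrite /prism leqNgt ltnW //= gtn_eqF. Qed.

(** This and the next two lemmas are the identities of a simplicial homotopy; off the diagonal they
    require that the face keep the class of [x 0]. *)
Lemma face_prism_le n i j x : (j <= i <= n)%N ->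
  band_le (x 0%N) (face n.+1 j x 0%N) -> forall k, (k <= n.+1)%N ->
  face n.+2 j (prism n.+1 i.+1 x) k = prism n i (face n.+1 j x) k.
Proof.
move=> /andP[ji i_n] xy k kn.
have Qk := tailp_face (leq_trans ji (leqW i_n)) xy.
have [kj|jk|->] := ltngtP k j; last first.
- by rewrite face_eq ?prism_le ?face_eq //; lia.
- rewrite face_gt //; last by lia.
  have [ki|ik|->] := ltngtP k i.+1.
  + by rewrite !prism_le ?face_gt //; lia.
  + rewrite !prism_gt ?Qk //; try by lia.
    by rewrite ifN; [congr tailp; lia|lia].
  + by rewrite !prism_eq Qk // ifN //; lia.
by rewrite face_lt ?prism_le ?face_lt //; lia.
Qed.

(** Both faces put [q_i] at place [i.+1], once as [x_(i+1) q_(i+1)] and once as [q_i q_i]. *)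
Lemma face_prism_diag n i x : (i <= n)%N -> forall k, (k <= n.+1)%N ->
  face n.+2 i.+1 (prism n.+1 i.+1 x) k = face n.+2 i.+1 (prism n.+1 i x) k.
Proof.
move=> i_n k kn; have [ki|ik|->] := ltngtP k i.+1.
- by rewrite !face_lt ?prism_le //; lia.
- by rewrite !face_gt ?prism_gt //; lia.
- rewrite !face_eq //; try by lia.
  by rewrite prism_le // !prism_eq prism_gt //= bandS -tailpS.
Qed.

(** Inside the tail, neighbours merge by [q_(j-1) q_j = q_(j-1)]; the cyclic face uses
    [x_0 g x_0 = x_0]. *)
Lemma face_prism_gt n i j x : (i < j <= n.+1)%N ->
  band_le (x 0%N) (face n.+1 j x 0%N) -> forall k, (k <= n.+1)%N ->
  face n.+2 j.+1 (prism n.+1 i x) k = prism n i (face n.+1 j x) k.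
Proof.
move=> /andP[ij jn] xy k kn.
have Qk := tailp_face jn xy.
have [jE|jn1] := eqVneq j n.+1.
  subst j; case: k kn => [|k] kn.
    rewrite face_last0 prism_gt // !prism_le // face_last0 tailpS // tailp_n.
    by rewrite -!mulgA [x 0%N * _]mulgA band_leE ?band_le_rep.
  rewrite face_last //; have [ki|ik|->] := ltngtP k.+1 i.+1.
  - by rewrite !prism_le ?face_last.
  - by rewrite !prism_gt ?Qk ?ifT //; lia.
  - by rewrite !prism_eq Qk ?ifT //; lia.
have [kj|jk|->] := ltngtP k j.+1.
- rewrite face_lt //; last by lia.
  have [ki|ik|->] := ltngtP k i.+1.
  + by rewrite !prism_le ?face_lt //; lia.
  + by rewrite !prism_gt ?Qk ?ifT //; lia.
  + by rewrite !prism_eq Qk ?ij //; lia.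
- rewrite face_gt ?prism_gt ?Qk ?ifN //; try by lia.
  by congr tailp; lia.
- rewrite face_eq ?prism_gt ?Qk ?ifT //; try by lia.
  by case: j ij jn xy Qk jn1 => // j *; rewrite tailp_absorb //; lia.
Qed.

Lemma face_prism_last n x : forall k, (k <= n)%N ->
  face n.+1 n.+1 (prism n n x) k = x k.
Proof.
move=> [|k] kn; last by rewrite face_last // prism_le.
rewrite face_last0 prism_eq tailp_n prism_le // band_leE //.
exact: band_le_rep.
Qed.

Lemma band_le_tailp n x (z : S) i : (i <= n)%N ->
  (forall k, (k <= n)%N -> band_le z (x k)) -> band_le z (tailp n x i).
Proof.
move=> i_n zx.
apply: (@tailp_ind n x (fun s => band_le z s)) i_n => [|k s kn zs].
  apply: band_le_meet => //; first exact: zx.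
  exact: (band_le_trans bandS (zx 0%N isT) (band_le_rep bandS _)).
by apply: band_le_meet => //; exact: zx.
Qed.

Lemma tailp_le n x i k : (i <= n)%N -> (k <= n)%N -> (k == 0%N) || (i < k)%N ->
  band_le (tailp n x i) (x k).
Proof.
move=> i_n kn; rewrite -(subKn i_n).
elim: (n - i)%N (leq_subr i n) => [_|m IH mn] ik.
  move: ik; rewrite subn0 tailp_n ltnNge kn orbF => /eqP ->.
  exact: band_le_mull.
rewrite tailpS -?subSn ?subSS //; last by lia.
have [->|kE] := eqVneq k (n - m)%N; first exact: band_le_mull.
by apply: (band_le_trans bandS (band_le_mulr bandS _ _)); apply: IH; lia.
Qed.

(** The face is [(x_0 q_0, q_0, ..., q_(n-1))]. Its first letter has every letter of [x] as a
    factor, and each [q_i] is a product of such letters and [g]. *)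
Lemma bottom_face_prism n x : bottom n (face n.+1 0 (prism n 0 x)).
Proof.
have E : face n.+1 0 (prism n 0 x) 0%N = x 0%N * tailp n x 0 by rewrite face_eq.
move=> [|k] kn; first exact: band_le_refl.
rewrite {}E face_gt //= prism_gt //=; apply: band_le_tailp => [|j jn].
  exact: ltnW.
by apply: (band_le_trans bandS (band_le_mulr bandS _ _)); apply: tailp_le; lia.
Qed.

Lemma prism_closed n i x (P : S -> Prop) :
  (forall a b, P a -> P b -> P (a * b)) -> (forall a, P a -> P (band_rep a)) ->
  (forall k, (k <= n)%N -> P (x k)) ->
  (i <= n)%N -> forall k, (k <= n.+1)%N -> P (prism n i x k).
Proof.
move=> PM Prep Px i_n k kn.
have PQ l : (l <= n)%N -> P (tailp n x l).
  by apply: (@tailp_ind n x P) => [|j s jn Ps]; apply: PM; auto; apply: Prep; auto.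
have [ki|ik|->] := ltngtP k i.+1.
- by rewrite prism_le //; apply: Px; lia.
- by rewrite prism_gt //; apply: PQ; lia.
- by rewrite prism_eq; apply: PQ.
Qed.

Lemma face_closed n j x (P : S -> Prop) :
  (forall a b, P a -> P b -> P (a * b)) ->
  (forall k, (k <= n)%N -> P (x k)) -> forall k, (k < n)%N -> P (face n j x k).
Proof.
move=> PM Px k kn; rewrite /face; case: ifP => jn.
  case: ifP => kj; first by apply: Px; lia.
  by case: ifP => _; [apply: PM|]; apply: Px; lia.
by case: ifP => _; [apply: PM|]; apply: Px; lia.
Qed.

(** An extra degeneracy: with [e] the representative, face 0 restores [x_0 e e x_0 = x_0]. *)
Definition cone x : nat -> S := fun k =>
  match k with
  | 0 => x 0%N * band_rep (x 0%N)
  | 1 => band_rep (x 0%N) * x 0%N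
  | k.+2 => x k.+1
  end.

Lemma face_cone0 n x k : (k <= n)%N -> face n.+1 0 (cone x) k = x k.
Proof.
case: k => [|k] kn; last by rewrite face_gt.
by rewrite face_eq //= mulgA -[_ * _ * band_rep _]mulgA bandS band_leE ?band_le_rep.
Qed.

Lemma bottom_face n j x : (j <= n.+1)%N -> bottom n.+1 x ->
  bottom n (face n.+1 j x) /\ band_rep (face n.+1 j x 0%N) = band_rep (x 0%N).
Proof.
move=> jn bx; have le0 : band_le (face n.+1 j x 0%N) (x 0%N).
  have [->|jn1] := eqVneq j n.+1; first by rewrite face_last0 band_le_mulr.
  case: j jn jn1 => [|j] jn jn1; first by rewrite face_eq // band_le_mull.
  by rewrite face_lt ?band_le_refl //; lia.
have bx' k : (k <= n)%N -> band_le (x 0%N) (face n.+1 j x k).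
  apply: (@face_closed n.+1 j x (fun s => band_le (x 0%N) s)) => // a b.
  exact: band_le_meet.
split=> [k kn|]; first exact: (band_le_trans bandS) le0 (bx' k kn).
by apply: eq_band_rep => //; exact: bx'.
Qed.

(** On bottom words no face changes the class of [x 0], so [e] stays the same. The end faces need
    [x_0 x_1 e = x_0 e] and [e x_(n+1) x_0 = e x_0], which hold by rectangularity. *)
Lemma face_cone n j x : (j <= n.+1)%N -> bottom n.+1 x ->
  forall k, (k <= n.+1)%N ->
  face n.+2 j.+1 (cone x) k = cone (face n.+1 j x) k.
Proof.
move=> jn bx k kn; have [_ rE] := bottom_face jn bx.
have le_rep l : (l <= n.+1)%N -> band_le (band_rep (x 0%N)) (x l).
  by move=> ln; apply: (band_le_trans bandS) (band_rep_le bandS _) (bx l ln).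
have [jE|jn1] := eqVneq j n.+1.
  subst j; case: k kn => [|[|k]] kn;
    rewrite ?face_last0 ?face_last //= ?rE ?face_last0 ?face_last //.
    by rewrite mulgA.
  by rewrite mulgA band_rect ?band_rep_le ?band_le_rep ?bx.
have {jn jn1} jn : (j < n.+1)%N by lia.
case: k kn => [|[|k]] kn.
- rewrite face_lt //= rE; case: j jn {rE} => [|j] jn; last by rewrite face_lt.
  by rewrite face_eq // band_rect ?band_le_rep ?le_rep.
- rewrite /= rE; case: j jn {rE} => [|j] jn; last by rewrite !face_lt.
  by rewrite !face_eq //= mulgA.
- have [kj|jk|jE] := ltngtP k.+1 j.
  + by rewrite /= !face_lt //; lia.
  + by rewrite /= !face_gt //; lia.
  + by subst j; rewrite /= !face_eq.
Qed.

End Prism.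

(** * Functions on words *)

(** Words of all lengths share the type of sequences; a function of [n.+1] letters is one that
    ignores later entries. *)
Definition is_local (S V : Type) (n : nat) (phi : (nat -> S) -> V) :=
  forall x y, (forall k, (k <= n)%N -> x k = y k) -> phi x = phi y.

Section WordCochains.
Local Open Scope ring_scope.
Variables (K : numDomainType) (S : semigroupType).
Implicit Types (phi psi : (nat -> S) -> K) (x y : nat -> S).

Definition is_bounded phi := exists M, forall x, `|phi x| <= M.

(** The Hochschild coboundary as seen on point masses. *)
Definition wdelta n phi x := \sum_(j < n.+2) (-1) ^+ j * phi (face n.+1 j x).

Definition is_wcochain n phi := is_local n phi /\ is_bounded phi.

Definition is_wcoboundary n phi :=
  exists2 psi, is_wcochain n psi & forall x, phi x = wdelta n psi x.

Lemma is_bounded_sum N (F : nat -> (nat -> S) -> K) :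
  (forall i, is_bounded (F i)) ->
  is_bounded (fun x => \sum_(i < N) (-1) ^+ i * F i x).
Proof.
move=> FM; elim: N => [|N [M NM]].
  by exists 0 => x; rewrite big_ord0 normr0.
have [M' M'P] := FM N; exists (M + M') => x.
rewrite big_ord_recr (le_trans (ler_normD _ _)) // lerD //.
by rewrite normrM normrX normrN1 expr1n mul1r.
Qed.

Lemma is_boundedD phi psi : is_bounded phi -> is_bounded psi ->
  is_bounded (fun x => phi x + psi x).
Proof.
move=> [M phiM] [N psiN]; exists (M + N) => x.
by rewrite (le_trans (ler_normD _ _)) // lerD.
Qed.

Lemma is_wcochainD n phi psi : is_wcochain n phi -> is_wcochain n psi ->
  is_wcochain n (fun x => phi x + psi x).
Proof.
move=> [phil phib] [psil psib]; split; last exact: is_boundedD.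
by move=> x y xy; rewrite (phil _ _ xy) (psil _ _ xy).
Qed.

Lemma is_wcochainN n phi : is_wcochain n phi -> is_wcochain n (fun x => - phi x).
Proof.
move=> [phil [M phiM]]; split; last by exists M => x; rewrite normrN.
by move=> x y xy; rewrite (phil _ _ xy).
Qed.

Lemma wdelta_wcochain n phi : is_wcochain n phi -> is_wcochain n.+1 (wdelta n phi).
Proof.
move=> [phil phib]; split.
  move=> x y xy; apply: eq_bigr => j _; congr (_ * _); apply: phil => k kn.
  exact: face_ext xy _ _.
apply: (@is_bounded_sum n.+2 (fun j x => phi (face n.+1 j x))) => j.
by case: phib => M phiM; exists M.
Qed.

Lemma wdeltaD n phi psi x :
  wdelta n (fun x => phi x + psi x) x = wdelta n phi x + wdelta n psi x.
Proof. by rewrite -big_split; apply: eq_bigr => j _; rewrite mulrDr. Qed.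

Lemma wdeltaN n phi x : wdelta n (fun x => - phi x) x = - wdelta n phi x.
Proof. by rewrite -sumrN; apply: eq_bigr => j _; rewrite mulrN. Qed.

Lemma wdelta_wdelta n phi x : is_local n phi -> wdelta n.+1 (wdelta n phi) x = 0.
Proof.
move=> phil; pose a i j := phi (face n.+1 i (face n.+2 j x)).
rewrite -[RHS](@face_sum0 _ n.+1 a) => [|i j ij jn]; last first.
  by apply: phil; apply: face_face.
rewrite exchange_big; apply: eq_bigr => j _; rewrite mulr_sumr.
by apply: eq_bigr => i _; rewrite mulrA -exprD addnC.
Qed.

Definition prism_homotopy n phi x := \sum_(i < n.+1) (-1) ^+ i * phi (prism n i x).

Hypothesis bandS : forall s : S, (s * s)%g = s.

Lemma tailp_ext n x y i : (forall k, (k <= n)%N -> x k = y k) ->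
  tailp n x i = tailp n y i.
Proof.
move=> xy; rewrite /tailp xy //; congr foldr; apply/eq_in_map => k.
by rewrite mem_iota => ?; apply: xy; lia.
Qed.

Lemma prism_homotopy_wcochain n phi :
  is_wcochain n.+1 phi -> is_wcochain n (prism_homotopy n phi).
Proof.
move=> [phil [M phiM]]; split; last first.
  by apply: (@is_bounded_sum n.+1 (fun i x => phi (prism n i x))) => i; exists M.
move=> x y xy; apply: eq_bigr => i _; congr (_ * _); apply: phil => k kn.
have i_n := ltn_ord i; have [ki|ik|->] := ltngtP k i.+1.
- by rewrite !prism_le ?xy //; lia.
- by rewrite !prism_gt // (tailp_ext _ xy).
- by rewrite !prism_eq (tailp_ext _ xy).
Qed.

(* The prism identities hold exactly unless a face strictly lowers the D-class of
   x_0; then both sides are words with a strictly lower first letter. *)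
Lemma prism_homotopy_eq0 n phi x (P : S -> Prop) :
  (forall a b, P a -> P b -> P (a * b)%g) -> (forall a, P a -> P (band_rep a)) ->
  (forall k, (k <= n.+1)%N -> P (x k)) ->
  is_local n.+1 phi -> (forall y, bottom n.+1 y -> phi y = 0) ->
  (forall y, (forall k, (k <= n.+1)%N -> P (y k)) -> band_le (y 0%N) (x 0%N) ->
     ~~ band_le (x 0%N) (y 0%N) -> phi y = 0) ->
  phi x + wdelta n (prism_homotopy n phi) x
    + prism_homotopy n.+1 (wdelta n.+1 phi) x = 0.
Proof.
move=> PM Prep Px phil phi0 philow.
pose a i j := phi (face n.+2 j (prism n.+1 i x)).
pose b i j := phi (prism n i (face n.+1 j x)).
have ab i j i' j' : (i <= n)%N -> (j <= n.+1)%N -> (i' <= n.+1)%N ->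
    (band_le (x 0%N) (face n.+1 j x 0%N) -> forall k, (k <= n.+1)%N ->
      face n.+2 j' (prism n.+1 i' x) k = prism n i (face n.+1 j x) k) ->
    face n.+2 j' (prism n.+1 i' x) 0%N = face n.+1 j x 0%N ->
    a i' j' = b i j.
  move=> i_n jn i'n E E0; rewrite /a /b.
  have [/E|xy] := boolP (band_le (x 0%N) (face n.+1 j x 0%N)); first exact: phil.
  have Py := face_closed j PM Px.
  have le0 : band_le (face n.+1 j x 0%N) (x 0%N).
    rewrite /face; case: ifP => jn1; last by rewrite band_le_mulr.
    by case: j {i_n jn i'n E E0 xy Py} jn1 => [|j] jn1;
      rewrite /= ?band_le_mull ?band_le_refl.
  transitivity (0 : K); first apply: philow; rewrite ?E0 //.
    by move=> k kn; apply: face_closed => //; apply: prism_closed.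
  by symmetry; apply: philow => //; apply: prism_closed.
have -> : wdelta n (prism_homotopy n phi) x =
    \sum_(i < n.+1) \sum_(j < n.+2) (-1) ^+ (i + j) * b i j.
  rewrite exchange_big; apply: eq_bigr => j _; rewrite mulr_sumr.
  by apply: eq_bigr => i _; rewrite mulrA -exprD addnC.
have -> : prism_homotopy n.+1 (wdelta n.+1 phi) x =
    \sum_(i < n.+2) \sum_(j < n.+3) (-1) ^+ (i + j) * a i j.
  apply: eq_bigr => i _; rewrite mulr_sumr.
  by apply: eq_bigr => j _; rewrite mulrA -exprD.
rewrite -addrA [X in phi x + X]addrC prism_sum.
(* The telescope leaves two ends: a bottom word, where [phi] vanishes, and [x] itself. *)
- have -> : a 0%N 0%N = 0 by apply/phi0/bottom_face_prism.
  have -> : a n.+1 n.+2 = phi x by apply: phil; apply: face_prism_last.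
  by rewrite sub0r subrr.
- move=> i j /andP[ji i_n]; apply: ab => //; try by lia.
    by move=> xy; apply: face_prism_le => //; lia.
  case: j ji => [|j] ji; first by rewrite !face_eq // !prism_le.
  by rewrite !face_lt ?prism_le //; lia.
- move=> i j /andP[ij jn]; apply: ab => //; try by lia.
    by move=> xy; apply: face_prism_gt => //; lia.
  have [jE|jn1] := eqVneq j n.+1.
    rewrite jE !face_last0 prism_gt; last by lia.
    rewrite prism_le // tailpS // tailp_n -!mulgA [(x 0%N * _)%g]mulgA.
    by rewrite band_leE ?band_le_rep.
  by rewrite !face_lt ?prism_le //; lia.
- by move=> i i_n; apply: phil; apply: face_prism_diag.
Qed.

(** The cocycle identity at [cone x] writes [phi x] as the alternating sum of [phi] over the cones
    of the faces of [x]. *)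
Lemma vanish_on_bottom n phi : is_wcochain n.+1 phi ->
  (forall x, wdelta n.+1 phi x = 0) ->
  exists2 psi, is_wcochain n psi &
    forall x, bottom n.+1 x -> phi x = wdelta n psi x.
Proof.
move=> [phil [M phiM]] phiZ.
(* Extension by zero is harmless: faces of bottom words are bottom. *)
exists (fun y => if `[< bottom n y >] then phi (cone y) else 0).
  split.
    move=> x y xy; have -> : `[< bottom n x >] = `[< bottom n y >].
      by apply/asboolP/asboolP => b k kn; have := b k kn; rewrite !xy.
    by case: ifP => // _; apply: phil => -[|[|k]] kn /=; rewrite !xy.
  exists M => x; case: ifP => // _; rewrite normr0.
  exact: le_trans (phiM x).
move=> x bx; apply/eqP; rewrite -subr_eq0 -(phiZ (cone x)) /wdelta.
rewrite [in X in _ == X]big_ord_recl expr0 mul1r -sumrN; apply/eqP; congr (_ + _).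
  by apply: phil => k kn; rewrite face_cone0.
apply: eq_bigr => j _; have jn : (j <= n.+1)%N by rewrite -ltnS.
rewrite (asboolT (bottom_face bandS jn bx).1) /= /bump leq0n add1n exprS mulN1r mulNr.
by congr (- (_ * _)); apply: phil => k kn; rewrite face_cone.
Qed.

(** * Bounded descent in a finitely generated semilattice *)

Section Rank.
Variables (N : nat) (G : 'I_N -> S).

Definition rank (s : S) := #|[pred i | band_le s (G i)]|.

(* In the structure semilattice, the class of s is the meet of the classes of the
   G i lying above it. *)
Definition is_meet (s : S) :=
  forall z, (forall i, band_le s (G i) -> band_le z (G i)) -> band_le z s.

Lemma is_meet_gen i : is_meet (G i).
Proof. by move=> z; apply; exact: band_le_refl. Qed.

Lemma is_meetM a b : is_meet a -> is_meet b -> is_meet (a * b)%g.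
Proof.
move=> ma mb z zab; apply: band_le_meet => //.
  by apply: ma => i ai; apply/zab/(band_le_trans bandS (band_le_mull bandS _ _) ai).
by apply: mb => i bi; apply/zab/(band_le_trans bandS (band_le_mulr bandS _ _) bi).
Qed.

Lemma is_meet_rep a : is_meet a -> is_meet (band_rep a).
Proof.
move=> ma z zr; apply: (band_le_trans bandS _ (band_le_rep bandS a)).
by apply: ma => i ai; apply/zr/(band_le_trans bandS (band_rep_le bandS _) ai).
Qed.

(** Generators above [s] are above [t]. Were there no others, [s] would lie below all generators
    above [t], hence below their meet [t]. *)
Lemma rank_lt s t : is_meet t -> band_le t s -> ~~ band_le s t ->
  (rank s < rank t)%N.
Proof.
move=> mt ts st; apply/proper_card/fintype.properP; split.
  by apply/fintype.subsetP => i; rewrite !inE; exact: (band_le_trans bandS ts).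
apply: contrapT => H; move/negP: st; apply; apply: mt => i ti.
by apply: contrapT => si; apply: H; exists i; rewrite inE //; apply/negP.
Qed.

End Rank.

(** A strictly lower first letter has larger rank, so earlier uses of the homotopy already kill such
    words, and one more use lowers the threshold by one. [psi] is chosen before [G], hence serves
    all words at once. *)
Lemma descend n phi : is_wcochain n.+1 phi ->
  (forall x, wdelta n.+1 phi x = 0) ->
  (forall x, bottom n.+1 x -> phi x = 0) -> forall k,
  exists phi' psi, [/\ is_wcochain n.+1 phi', is_wcochain n psi,
    forall x, bottom n.+1 x -> phi' x = 0,
    forall x, phi' x = phi x + wdelta n psi x &
    forall (G : 'I_n.+2 -> S) x, (forall i, (i <= n.+1)%N -> is_meet G (x i)) ->
      (n.+2 < rank G (x 0%N) + k)%N -> phi' x = 0].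
Proof.
move=> phic phiZ phi0; elim=> [|k [phi' [psi [phi'c psic phi'0 phi'E IH]]]].
  exists phi, (fun=> 0); split=> //.
  - by split=> //; exists 0 => x; rewrite normr0.
  - by move=> x; rewrite /wdelta big1 ?addr0 // => i _; rewrite mulr0.
  (* No rank exceeds the number [n.+2] of generators. *)
  - move=> G x _; rewrite addn0 ltnNge.
    by rewrite (leq_trans (max_card _)) // card_ord.
have phi'Z x : wdelta n.+1 phi' x = 0.
  transitivity (wdelta n.+1 (fun x => phi x + wdelta n psi x) x).
    by apply: eq_bigr => j _; rewrite phi'E.
  by rewrite wdeltaD phiZ wdelta_wdelta ?addr0 //; case: psic.
have hZ x : prism_homotopy n.+1 (wdelta n.+1 phi') x = 0.
  by rewrite /prism_homotopy big1 // => i _; rewrite phi'Z mulr0.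
have hc := prism_homotopy_wcochain phi'c.
exists (fun x => phi' x + wdelta n (prism_homotopy n phi') x).
exists (fun x => psi x + prism_homotopy n phi' x); split.
- exact/is_wcochainD/wdelta_wcochain.
- exact: is_wcochainD.
(* The added term is zero because [phi'] is a cocycle. All letters stay above [x 0], so no first
   letter is strictly lower. *)
- move=> x bx; rewrite -[LHS]addr0 -[X in _ + X = _](hZ x).
  apply: (@prism_homotopy_eq0 _ _ x (fun s => band_le (x 0%N) s)) => //.
  + by move=> a b; exact: band_le_meet.
  + by move=> a xa; exact: (band_le_trans bandS xa (band_le_rep bandS _)).
  + by case: phi'c.
  + by move=> y Py _; rewrite Py.
- by move=> x; rewrite phi'E -addrA wdeltaD.
- move=> G x Gx rx; rewrite -[LHS]addr0 -[X in _ + X = _](hZ x).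
  apply: (@prism_homotopy_eq0 _ _ x (is_meet G)) => //.
  + exact: is_meetM.
  + exact: is_meet_rep.
  + by case: phi'c.
  + move=> y Gy yx xy; apply: (IH G) => //; have := rank_lt (Gy 0%N isT) yx xy.
    by lia.
Qed.

Theorem wcocycle_coboundary n phi : is_wcochain n.+1 phi ->
  (forall x, wdelta n.+1 phi x = 0) -> is_wcoboundary n phi.
Proof.
move=> phic phiZ; have [psi0 psi0c phi0] := vanish_on_bottom phic phiZ.
pose phi1 x := phi x - wdelta n psi0 x.
have phi1c : is_wcochain n.+1 phi1.
  exact/is_wcochainD/is_wcochainN/wdelta_wcochain.
have phi1Z x : wdelta n.+1 phi1 x = 0.
  by rewrite wdeltaD phiZ wdeltaN wdelta_wdelta ?subrr //; case: psi0c.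
have phi10 x : bottom n.+1 x -> phi1 x = 0.
  by move=> bx; rewrite /phi1 phi0 // subrr.
(* With [n.+3] uses the rank condition holds whatever the rank; below, [G] lists the letters of [x]
   itself. *)
have [phi' [psi [_ psic _ phi'E phi'0]]] := descend phi1c phi1Z phi10 n.+3.
exists (fun x => psi0 x - psi x); first exact/is_wcochainD/is_wcochainN.
move=> x; rewrite wdeltaD wdeltaN; have := phi'E x.
rewrite (phi'0 (fun i : 'I_n.+2 => x i)) ?ltn_addl //.
  rewrite /phi1 => E; apply/eqP; rewrite -subr_eq0; apply/eqP.
  by rewrite [RHS]E; ring.
by move=> i i_n; have := @is_meet_gen _ (fun i : 'I_n.+2 => x i) (Ordinal (i_n : (i < n.+2)%N)).
Qed.

End WordCochains.

(** * Multilinear extension and density *)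

Section Dirac.
Local Open Scope ring_scope.
Variables (R : realType) (S : choiceType).
Local Notation C := R[i].
Local Notation ell1 := (ell1 R S).
Import Normc.

Lemma dirac_bound (s : S) :
  nsummable (fun t => normc ((t == s)%:R : C)) /\
  nsum (fun t => normc ((t == s)%:R : C)) <= 1.
Proof.
apply: nsum_le_fset => [t|X]; first exact: normc_ge0.
have [sX|sX] := boolP (s \in X).
  rewrite (bigD1_seq s) ?fset_uniq //= eqxx normc1 big1 ?addr0 // => t /negPf ->.
  by rewrite normc0.
rewrite big1_seq ?ler01 // => t /andP[_ tX].
by rewrite (_ : t == s = false) ?normc0 //; apply: contraNF sX => /eqP <-.
Qed.

Lemma dirac_subproof (s : S) : (fun t => (t == s)%:R) \in @ell1_pred R S.
Proof. exact/asboolP/(dirac_bound s).1. Qed.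

Definition dirac s : ell1 := Ell1 (dirac_subproof s).

Lemma diracE s t : dirac s t = (t == s)%:R. Proof. by []. Qed.

Lemma norm_dirac_le1 s : `|dirac s| <= 1.
Proof. by rewrite ell1_normE lecR (dirac_bound s).2. Qed.

Lemma ell1_sumE I (r : seq I) (F : I -> ell1) t :
  (\sum_(i <- r) F i) t = \sum_(i <- r) F i t.
Proof. by elim/big_rec2: _ => // i x y _ <-. Qed.

(** Take a finite set carrying all but [e] of the norm; the error is the part of [f] outside it. *)
Lemma ell1_approx (f : ell1) (e : R) : 0 < e ->
  exists X : {fset S}, ell1_rnorm (f - \sum_(s <- X) f s *: dirac s) <= e.
Proof.
move=> e0; have fs := ell1_summable f; pose p s := normc (f s).
have p0 s : 0 <= p s by exact: normc_ge0.
have [X Xe] : exists X : {fset S}, nsum p - e < \sum_(s <- X) p s.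
  apply: contrapT => H; have [|_] := @nsum_le_fset _ _ p (nsum p - e) p0.
    move=> X; rewrite leNgt; apply/negP => Xe; apply: H; exists X; exact: Xe.
  by rewrite lerBrDr gerDl leNgt e0.
exists X; pose pX s := if s \in X then p s else 0.
pose pY s := if s \in X then 0 else p s.
have -> : ell1_rnorm (f - \sum_(s <- X) f s *: dirac s) = nsum pY.
  congr nsum; apply/funext => t.
  rewrite -[X in normc X]/(f t - (\sum_(s <- X) f s *: dirac s) t) ell1_sumE /pY.
  case: ifP => tX.
    rewrite (bigD1_seq t) ?fset_uniq //= big1 => [|s st].
      by rewrite addr0 -[X in _ - X]/(f t * (t == t)%:R) eqxx mulr1 subrr normc0.
    by rewrite -[LHS]/(f s * (t == s)%:R) eq_sym (negPf st) mulr0.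
  rewrite big1_seq ?subr0 // => s /andP[_ sX].
  rewrite -[LHS]/(f s * (t == s)%:R) (_ : t == s = false) ?mulr0 //.
  by apply: contraFF tX => /eqP ->.
have pX0 s : 0 <= pX s by rewrite /pX; case: ifP.
have pY0 s : 0 <= pY s by rewrite /pY; case: ifP.
have pXs : nsummable pX.
  by apply: nsummable_le fs => s; rewrite /pX; case: ifP => _; rewrite ?p0 ?lexx.
have pYs : nsummable pY.
  by apply: nsummable_le fs => s; rewrite /pY; case: ifP => _; rewrite ?p0 ?lexx.
have pE : nsum p = nsum pX + nsum pY.
  rewrite -nsumD //; congr nsum; apply/funext => s; rewrite /pX /pY.
  by case: ifP; rewrite ?addr0 ?add0r.
have := nsum_ge_fset X pX0 pXs.
rewrite (eq_big_seq p) => [|s sX]; last by rewrite /pX sX.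
by move: Xe; rewrite pE; lra.
Qed.

Lemma functional_eq0 (f : ell1 -> C^o) (M : C) : linear f ->
  (forall a, `|f a| <= M * `|a|) -> (forall s, f (dirac s) = 0) ->
  forall a, f a = 0.
Proof.
move=> fl fM f0 a.
have fD u v : f (u + v) = f u + f v by have := fl 1 u v; rewrite !scale1r.
have f00 : f 0 = 0 by apply: (addrI (f 0)); rewrite -fD !addr0.
have fX (X : {fset S}) : f (\sum_(s <- X) a s *: dirac s) = 0.
  elim/big_rec: _ => // s u _ u0; rewrite fD u0 addr0.
  by have := fl (a s) (dirac s) 0; rewrite f00 f0 !addr0 scaler0.
have small (e : R) : 0 < e -> `|f a| <= `|M| * e%:C%C.
  move=> e0; have [X Xe] := ell1_approx a e0.
  rewrite -[a](subrK (\sum_(s <- X) a s *: dirac s)) fD fX addr0.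
  have le1 := fM (a - \sum_(s <- X) a s *: dirac s).
  rewrite (le_trans le1) //.
  have := le_trans (normr_ge0 _) le1 => /ger0_norm <-.
  by rewrite normrM normr_id ler_wpM2l // ell1_normE lecR.
apply/eqP; rewrite -normr_eq0 normcNE; apply/eqP.
have nM : 0 <= normc M by exact: normc_ge0.
have small' e : 0 < e -> normc (f a) <= normc M * e.
  by move=> /small; rewrite !normcNE -rmorphM lecR.
congr (_%:C%C); apply/eqP; rewrite eq_le normc_ge0 andbT.
apply/ler_addgt0Pr => e e0; rewrite add0r.
(* Adding one keeps the divisor positive even when [M] is zero. *)
have M1 : 0 < normc M + 1 by rewrite ltr_wpDl.
apply: le_trans (small' (e / (normc M + 1)) _) _; first by rewrite divr_gt0.
rewrite mulrCA; apply: ler_piMr; first exact: ltW.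
by rewrite ler_pdivrMr // mul1r lerDl.
Qed.

End Dirac.

(** * Multilinear extension from point masses *)

Section Multilinear.
Local Open Scope ring_scope.
Variables (R : realType) (S : choiceType).
Local Notation C := R[i].
Local Notation ell1 := (ell1 R S).
Import Normc.

(** Tonelli by induction on the length, splitting off the first letter. *)
Lemma nsummable_bigprod n (p : 'I_n -> S -> R) :
  (forall i s, 0 <= p i s) -> (forall i, nsummable (p i)) ->
  let q := fun w : {ffun 'I_n -> S} => \prod_i p i (w i) in
  nsummable q /\ nsum q = \prod_i nsum (p i).
Proof.
elim: n p => [|n IH] p p0 ps q.
  have [w0 w0E] : exists w0, forall w : {ffun 'I_0 -> S}, w = w0.
    have f0 : 'I_0 -> S by case.
    by exists (finfun f0) => w; apply/ffunP => -[].
  have E : (\esum_(w in [set: {ffun 'I_0 -> S}]) (q w)%:E = 1%:E)%E.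
    rewrite (_ : [set: _] = [set w0])%classic; last first.
      by apply/seteqP; split => w //= _; exact: w0E.
    by rewrite esum_set1 /q big_ord0 ?lee_fin.
  by rewrite /nsummable /nsum E ltry big_ord0.
pose e (z : S * {ffun 'I_n -> S}) : {ffun 'I_n.+1 -> S} :=
  [ffun i => oapp z.2 z.1 (unlift ord0 i)].
have eb : bijective e.
  exists (fun w : {ffun 'I_n.+1 -> S} =>
    (w ord0, [ffun i : 'I_n => w (lift ord0 i)])) => [[s w]|w].
    rewrite /e !ffunE unlift_none; congr pair; apply/ffunP => i.
    by rewrite !ffunE liftK.
  apply/ffunP => i; rewrite /e !ffunE /=.
  by case: unliftP => [j ->|->] //=; rewrite ffunE.
have [qs qE] := IH (fun i => p (lift ord0 i)) (fun i => p0 _) (fun i => ps _).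
have [|zs zE] := nsummable_prod (p0 ord0) _ (ps ord0) qs.
  by move=> w; apply: prodr_ge0 => i _.
have E : (\esum_(w in [set: {ffun 'I_n.+1 -> S}]) (q w)%:E =
    \esum_(z in [set: S * {ffun 'I_n -> S}])
      (p ord0 z.1 * \prod_i p (lift ord0 i) (z.2 i))%:E)%E.
  rewrite (esum_reindexT _ eb); apply: eq_esum => z _; congr EFin.
  rewrite /q big_ord_recl /e ffunE unlift_none; congr (_ * _).
  by apply: eq_bigr => i _; rewrite ffunE liftK.
split; first by rewrite /nsummable E.
by rewrite [LHS]/nsum E -/(nsum _) zE big_ord_recl qE.
Qed.

(* The multilinear map on l^1(S) that takes the values psi on point masses. *)
Definition mext m (psi : (nat -> S) -> C) (c : 'I_m.+1 -> ell1) : C :=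
  csum setT (fun w : {ffun 'I_m.+1 -> S} =>
    psi (fun k => w (inord k)) * \prod_i c i (w i)).

Lemma normc_prod I (r : seq I) (F : I -> C) :
  normc (\prod_(i <- r) F i) = \prod_(i <- r) normc (F i).
Proof. by elim/big_rec2: _ => [|i x y _ <-]; rewrite ?normc1 ?normcM. Qed.

Section Bounded.
Variables (m : nat) (psi : (nat -> S) -> C) (M : R).
Hypotheses (M_ge0 : 0 <= M) (psiM : forall x, normc (psi x) <= M).

Lemma prod_summable (c : 'I_m.+1 -> ell1) :
  csummable (fun w : {ffun 'I_m.+1 -> S} => \prod_i c i (w i)) /\
  nsum (fun w : {ffun 'I_m.+1 -> S} => normc (\prod_i c i (w i))) =
    \prod_i ell1_rnorm (c i).
Proof.
rewrite /csummable; under eq_fun do rewrite normc_prod.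
by apply: nsummable_bigprod => [i s|i]; [exact: normc_ge0|exact: ell1_summable].
Qed.

Lemma mext_summable (c : 'I_m.+1 -> ell1) :
  csummable (fun w : {ffun 'I_m.+1 -> S} =>
    psi (fun k => w (inord k)) * \prod_i c i (w i)).
Proof. exact: csummable_bdd (fun w => psiM _) (prod_summable c).1. Qed.

Lemma mext_norm (c : 'I_m.+1 -> ell1) :
  `|mext psi c| <= M%:C%C * \prod_i `|c i|.
Proof.
have [cs cE] := prod_summable c; have cs0 w := normc_ge0 (\prod_i c i (w i)).
rewrite normcNE.
have -> : \prod_i `|c i| = (\prod_i ell1_rnorm (c i))%:C%C by rewrite rmorph_prod.
rewrite -rmorphM lecR (le_trans (normc_csum (mext_summable c))) //.
rewrite -cE -nsumZ //; apply: nsum_le => [w|w|]; first exact: normc_ge0.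
  by rewrite normcM ler_wpM2r.
exact: nsummableZ.
Qed.

Lemma mext_linear (c : 'I_m.+1 -> ell1) i k (f g : ell1) :
  mext psi (fun j => if j == i then k *: f + g else c j) =
  k * mext psi (fun j => if j == i then f else c j)
  + mext psi (fun j => if j == i then g else c j).
Proof.
rewrite /mext -(csumZ k (mext_summable _)).
rewrite -(csumD (csummableZ k (mext_summable _)) (mext_summable _)).
congr csum; apply/funext => w; rewrite mulrCA -mulrDr; congr (_ * _).
have E h : \prod_(j < m.+1) (if j == i then h else c j) (w j) =
    h (w i) * \prod_(j < m.+1 | j != i) c j (w j).
  rewrite (bigD1 i) //= eqxx; congr (_ * _).
  by apply: eq_bigr => j /negPf ->.
by rewrite !E -[(k *: f + g) _]/(k * f (w i) + g (w i)) mulrDl mulrA.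
Qed.

End Bounded.

Lemma mext_dirac m (psi : (nat -> S) -> C) (x : nat -> S) :
  is_local m psi -> mext psi (fun i : 'I_m.+1 => dirac R (x i)) = psi x.
Proof.
move=> psil; rewrite /mext (csum1 (a := [ffun i : 'I_m.+1 => x i])).
  rewrite big1 ?mulr1 => [|i _]; last by rewrite diracE ffunE eqxx.
  by apply: psil => k km; rewrite ffunE inordK.
move=> w wx; have /existsP[i wi] : [exists i, w i != x i].
  apply: contraNT wx => /existsPn H; apply/eqP/ffunP => i; rewrite ffunE.
  by apply/eqP; move: (H i); rewrite negbK.
by rewrite (bigD1 i) //= (negPf wi) mul0r mulr0.
Qed.

End Multilinear.

(** * Passage between cochains and functions on words *)

Section Ell1Cochains.
Local Open Scope ring_scope.
Variables (R : realType) (S : semigroupType).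
Local Notation C := R[i].
Local Notation ell1 := (ell1 R S).
Local Notation dirac := (@dirac R S).
Import Normc.

Lemma dirac_mul (s t : S) : dirac s ∗ dirac t = dirac (s * t)%g.
Proof.
apply: ell1_ext => u; rewrite -[LHS]/(convol_fun (dirac s) (dirac t) u) convol_funE.
rewrite pushE (csum1 (a := (s, t))) /=; first by rewrite !eqxx mulr1 eq_sym; case: eqP.
move=> [a b] /=; rewrite xpair_eqE => ab; case: ifP => // _.
by move: ab; case: eqP => //= _; [move=> /negPf ->; rewrite mulr0|rewrite mul0r].
Qed.

(** Combinations of point masses are dense and [T] is bounded, so the arguments can be freed one at
    a time. *)
Lemma cochain_eq0 n (T : cochain ell1 n) :
  (forall (x : 'I_n -> S) y, T (fun i => dirac (x i)) (dirac y) = 0) -> T = 0.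
Proof.
move=> T0; have [Tl _] := cochainP T; have [M M0 TM] := cochain_bound T.
(* [k] counts the leading slots holding arbitrary elements; the others hold point masses. *)
suff H k : (k <= n)%N -> forall a : 'I_n -> ell1,
    (forall i : 'I_n, (k <= i)%N -> exists s, a i = dirac s) -> forall b, T a b = 0.
  apply: cochain_ext => a; apply: tdual_ext => b; apply: (H n) => // i.
  by rewrite leqNgt ltn_ord.
elim: k => [_ a ad b|k IH kn a ad b].
  have [x xE] := choice (fun i => ad i isT).
  have -> : a = fun i => dirac (x i) by apply/funext.
  have [fl [N fN]] := tdualP (T (fun i => dirac (x i))).
  by apply: (functional_eq0 fl fN) => s; exact: T0.
pose i := Ordinal kn; have aE : a = upd a i (a i).
  by apply/funext => j; rewrite /upd; case: eqP => [->|].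
(* The bound of [T] with slot [i] left out bounds the functional in that slot. *)
rewrite aE; pose N := M * (\prod_(j < n | j != i) `|a j|) * `|b|.
apply: (@functional_eq0 _ _ (fun x => T (upd a i x) b) N).
- by move=> c x y; rewrite Tl.
- move=> x; rewrite (le_trans (TM _ _)) // /N (bigD1 i) //= {1}/upd eqxx.
  rewrite (eq_bigr (fun j => `|a j|)) => [|j /negPf ji]; last by rewrite /upd ji.
  rewrite le_eqVlt; apply/orP; left; apply/eqP; ring.
- move=> s; apply: IH => [|j kj]; first exact: ltnW.
  rewrite /upd; case: eqP => [_|/eqP ji]; first by exists s.
  by apply: ad; rewrite ltn_neqAle kj andbT; apply: contra ji => /eqP kE; apply/eqP/val_inj.
Qed.

(** The argument of the functional comes first, as in cyclic words. *)
Definition ccons m (b : ell1) (a : 'I_m -> ell1) : 'I_m.+1 -> ell1 :=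
  fun i => oapp a b (unlift ord0 i).

Lemma ccons0 m b (a : 'I_m -> ell1) :
  ccons b a = fun j => if j == ord0 then b else ccons 0 a j.
Proof.
apply/funext => j; rewrite /ccons; case: unliftP => [i ->|->]; last by rewrite eqxx.
by rewrite eq_sym (negPf (neq_lift _ _)).
Qed.

Lemma ccons_upd m b (a : 'I_m -> ell1) i x :
  ccons b (upd a i x) = fun j => if j == lift ord0 i then x else ccons b a j.
Proof.
apply/funext => j; rewrite /ccons; case: unliftP => [l ->|->] /=.
  by rewrite /upd (inj_eq (@lift_inj _ _)).
by [].
Qed.

Lemma bounded_normc (psi : (nat -> S) -> C) : is_bounded psi ->
  exists2 M : R, 0 <= M & forall x, normc (psi x) <= M.
Proof.
move=> [M psiM]; exists (normc M); first exact: normc_ge0.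
move=> x; rewrite -lecR -!normcNE; apply: le_trans (psiM x) _.
by rewrite ger0_norm // (le_trans _ (psiM x)).
Qed.

Lemma mext_cochain m (psi : (nat -> S) -> C) : is_bounded psi ->
  exists U : cochain ell1 m, forall a b, U a b = mext psi (ccons b a).
Proof.
move=> /bounded_normc[M M0 psiM].
have bnd (a : 'I_m -> ell1) b :
    `|mext psi (ccons b a)| <= M%:C%C * (\prod_i `|a i|) * `|b|.
  rewrite (le_trans (mext_norm M0 psiM _)) // big_ord_recl.
  rewrite {1}/ccons unlift_none /= le_eqVlt; apply/orP; left; apply/eqP.
  under eq_bigr do rewrite /ccons liftK /=.
  by ring.
have Ud (a : 'I_m -> ell1) : (fun b => mext psi (ccons b a)) \in @tdual_pred _ ell1.
  apply/asboolP; split; last by exists (M%:C%C * (\prod_i `|a i|)); exact: bnd.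
  by move=> k f g; rewrite ccons0 (mext_linear psiM) -!ccons0.
have Uc : (fun a => Dual (Ud a)) \in @cochain_pred _ ell1 m.
  apply/asboolP; split; last by exists (M%:C%C); exact: bnd.
  move=> a i k f g; apply: tdual_ext => b.
  rewrite tdualDE tdualZE -[LHS]/(mext psi (ccons b _)).
  by rewrite ccons_upd (mext_linear psiM) -!ccons_upd.
by exists (Cochain Uc).
Qed.

Definition word_val n (T : cochain ell1 n) (x : nat -> S) : C :=
  T (fun i => dirac (x i.+1)) (dirac (x 0%N)).

Lemma word_val_wcochain n (T : cochain ell1 n) : is_wcochain n (word_val T).
Proof.
split=> [x y xy|].
  rewrite /word_val xy //; congr (tdual_val (cochain_val T _) _).
  by apply/funext => i; rewrite xy.
have [M M0 TM] := cochain_bound T; exists M => x; rewrite (le_trans (TM _ _)) //.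
rewrite -mulrA ler_piMr // mulr_ile1 ?prodr_ge0 ?norm_dirac_le1 //.
by apply: prodr_ile1 => i _; rewrite normr_ge0 norm_dirac_le1.
Qed.

(** Point masses multiply to point masses, so each Hochschild term is a face; the two module actions
    give the first face and the cyclic one. *)
Lemma word_val_hdelta n (T : cochain ell1 n) x :
  word_val (hdelta T) x = wdelta n (word_val T) x.
Proof.
rewrite /word_val -[LHS]/(hdelta_fun T _ _) hdelta_funE !dirac_mul.
rewrite /wdelta big_ord_recl big_ord_recr /= expr0 mul1r addrA.
have E (a a' : 'I_n -> ell1) s s' : a = a' -> s = s' ->
  T a (dirac s) = T a' (dirac s') by move=> -> ->.
congr (_ + _ + _).
- apply: eq_bigr => j _; have jn := ltn_ord j.
  rewrite /bump leq0n add1n; congr (_ * _); apply: E; last by rewrite face_lt.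
  apply/funext => i; rewrite /Defs.contract /init /tail /=.
  have [ij|ji|/val_inj ->] := ltngtP i j.
  + by rewrite face_lt //; lia.
  + by rewrite -val_eqE /= gtn_eqF // face_gt //; lia.
  + by rewrite eqxx face_eq // dirac_mul.
- rewrite /bump leq0n add1n; congr (_ * _); apply: E; last by rewrite face_last0.
  by apply/funext => i; rewrite /init face_last.
Qed.

End Ell1Cochains.

(** * Vanishing of the simplicial cohomology *)

Local Open Scope ring_scope.

Theorem theorem7p4 (R : realType) (S : semigroupType)
    (bandS : forall s : S, (s * s)%g = s) (n : nat) (n_ge1 : (1 <= n)%N) :
  forall c : HH (ell1 R S) n, c = 0.
Proof.
case: n n_ge1 => // n _; apply/HH_eq0P => T T0.
have [|psi [psil psib] TE] := wcocycle_coboundary bandS (word_val_wcochain T).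
  by move=> x; rewrite -word_val_hdelta T0.
have [U UE] := mext_cochain n psib.
(* By density, [T] and [hdelta U] need only be compared on point masses, where [z] lists the
   arguments as one cyclic word. *)
exists U; apply/eqP; rewrite -subr_eq0; apply/eqP/cochain_eq0 => x y.
pose z k := if k is k'.+1 then x (inord k') else y.
rewrite -[LHS]/(T _ _ - hdelta U _ _).
have zE : (fun i : 'I_n.+1 => dirac R (x i)) = fun i : 'I_n.+1 => dirac R (z i.+1).
  by apply/funext => i; rewrite /z inord_val.
rewrite zE -[T _ _]/(word_val T z) -[X in _ - X]/(word_val (hdelta U) z).
rewrite TE word_val_hdelta; apply/eqP; rewrite subr_eq0; apply/eqP.
apply: eq_bigr => j _; congr (_ * _); rewrite /word_val UE -(mext_dirac _ psil).
congr mext; apply/funext => i; rewrite /ccons.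
by case: unliftP => [l ->|->].
Qed.
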